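(* Let $n=3p_1\cdots p_t q_1\cdots q_s\equiv 3,9,15\pmod{24}$, where $p_1,\dots,p_t,q_1,\dots,q_s$ are distinct odd primes with $p_i\equiv 1\pmod 3$, $q_j\equiv 2\pmod 3$, and $t+s\geqslant 1$. Let $P=p_1\cdots p_t$, $Q=q_1\cdots q_s$, and $E=E_{n,\frac{\pi}{3}}: y^2=x(x-n)(x+3n)$. (I.1) If $PQ\equiv 1\pmod 3$, then $S'(E)=\{1,n,-\frac{n}{3},-3\}$ if and only if $s=0$ and $G(n)$ (with $n=3p_1\cdots p_t$, $t\geqslant1$) is an odd graph. (I.2) If $PQ\equiv 2\pmod 3$, then $S'(E)=\{1,n,-\frac n3,-3\}$ if and only if $s=1$ and, in the graph $G(n)$, all nontrivial partitions $\{V_1,\overline V_1\}$ of $V=\{3,p_1,\dots,p_t,q_1\}$ with $V_1\subseteq\{p_1,\dots,p_t\}$ are odd. (II.1) If $PQ\equiv1\pmod3$ and $s=0$ (so $n=3p_1\cdots p_t$, $t\ge1$), then $S(E)=\{1\}$ if and only if $n\equiv 9\pmod{24}$ and $G(n/3)$ is an odd graph. (II.2) If $PQ\equiv 2\pmod 3$ and $s=1$ (so $n=3p_1\cdots p_tq_1$), then $S(E)=\{1\}$ if and only if, in the graph $G(-n)$, all nontrivial partitions $\{V_1,\overline V_1\}$ of $V=\{-1,3,p_1,\dots,p_t,q_1\}$ with $V_1\subseteq\{3,p_1,\dots,p_t\}$, $d(V_1)\equiv1\pmod 4$ and $\left(\frac{d(V_1)}{q_1}\right)=1$ are odd.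
   Context: Selmer groups: for an elliptic curve $E: y^2=x^3+Ax^2+Bx$ ($A,B\in\mathbb{Z}$, $B^2(A^2-4B)\ne0$), let $E': y^2=x^3-2Ax^2+(A^2-4B)x$, $M=\{\infty\}\cup\{p \text{ prime}: p\mid B^2(A^2-4B)\}$, $\mathbb{Q}_\infty=\mathbb{R}$, and $D\subseteq\mathbb{Q}^*/\mathbb{Q}^{*2}$ the subgroup generated by $-1$ and primes dividing $B^2(A^2-4B)$ (elements represented by square-free integers). For $p\in M$, $\delta_p:E'(\mathbb{Q}_p)\to\mathbb{Q}_p^*/\mathbb{Q}_p^{*2}$ sends $O\mapsto1$, $(0,0)\mapsto A^2-4B$, $(x,y)\mapsto x$ otherwise; $\delta'_p:E(\mathbb{Q}_p)\to\mathbb{Q}_p^*/\mathbb{Q}_p^{*2}$ sends $O\mapsto1$, $(0,0)\mapsto B$, $(x,y)\mapsto x$ otherwise. $S(E)=\{d\in D: d\in\mathrm{Im}\,\delta_p\ \forall p\in M\}$ and $S'(E)=\{d\in D: d\in\mathrm{Im}\,\delta'_p\ \forall p\in M\}$. For $E_{n,\frac{\pi}{3}}$, $A=2n$, $B=-3n^2$. Graphs: for $m=\pm r_1\cdots r_k$ (distinct primes, possibly including $3$), $G(m)$ is the directed graph with vertex set $\{r_1,\dots,r_k\}$ if $m>0$ and $\{-1,r_1,\dots,r_k\}$ if $m<0$, with an arc $r_i\to v$ ($v\ne r_i$) exactly when $r_i\equiv1\pmod3$ and the Legendre symbol $\left(\frac{v}{r_i}\right)=-1$ (no arcs leave $-1$,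 $3$, or primes $\equiv 2\pmod 3$). A partition $\{V_1,V_2\}$ of the vertex set is nontrivial if both parts are nonempty; it is odd if some vertex of one part has an odd number of arcs into the other part. The graph is odd if every nontrivial partition is odd. $\overline V_1$ is the complement of $V_1$ and $d(V_1)=\prod_{v\in V_1}v$. *)

(* Defs.v *)
From HB Require Import structures.
From mathcomp Require Import all_boot all_order all_algebra.
From mathcomp Require Import finmap.
From mathcomp Require Import boolp classical_sets reals.

Set Implicit Arguments.
Unset Strict Implicit.
Unset Printing Implicit Defensive.

Import Order.TTheory GRing.Theory Num.Theory.

(* The ring Z_p as the inverse limit of the Z/p^k: a p-adic integer is the
   sequence of its residues, the k-th one being reduced modulo p^k. *)
Record padic_int (p : nat) (p_pr : prime p) := PadicInt {
  residue :> nat -> nat;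
  residueP : forall k, residue k = residue k.+1 %% p ^ k }.

Section PadicInt.
Variables (p : nat) (p_pr : prime p).
Implicit Types x y z : padic_int p_pr.

HB.instance Definition _ := gen_eqMixin (padic_int p_pr).
HB.instance Definition _ := gen_choiceMixin (padic_int p_pr).

Lemma padic_eqP x y : residue x =1 residue y -> x = y.
Proof.
case: x y => [x xP] [y yP] /= /funext xy; rewrite xy in xP *.
by congr PadicInt; exact: Prop_irrelevance.
Qed.

Lemma residue_small x k : x k %% p ^ k = x k.
Proof. by rewrite [x k]residueP modn_mod. Qed.

Lemma residue_mod x i j : i <= j -> x j %% p ^ i = x i.
Proof.
elim: j => [|j IHj]; first by rewrite leqn0 => /eqP ->; exact: residue_small.
rewrite leq_eqVlt => /predU1P [->|]; first exact: residue_small.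
by rewrite ltnS => le_ij; rewrite -(IHj le_ij) [x j]residueP modn_dvdm ?dvdn_exp2l.
Qed.

Fact modpX_coherent (f : nat -> nat) :
  (forall k, f k = f k.+1 %[mod p ^ k]) ->
  forall k, f k %% p ^ k = (f k.+1 %% p ^ k.+1) %% p ^ k.
Proof. by move=> fP k; rewrite modn_dvdm ?dvdn_exp2l // fP. Qed.

Fact padic_nat_subproof (n : nat) k : n = n %[mod p ^ k].
Proof. by []. Qed.
Definition padic_nat (n : nat) : padic_int p_pr :=
  PadicInt p_pr (modpX_coherent (padic_nat_subproof n)).

Fact padic_add_subproof x y k : x k + y k = x k.+1 + y k.+1 %[mod p ^ k].
Proof. by rewrite (residueP x) (residueP y) modnDm. Qed.
Definition padic_add x y : padic_int p_pr :=
  PadicInt p_pr (modpX_coherent (padic_add_subproof x y)).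

Fact padic_mul_subproof x y k : x k * y k = x k.+1 * y k.+1 %[mod p ^ k].
Proof. by rewrite (residueP x) (residueP y) modnMm. Qed.
Definition padic_mul x y : padic_int p_pr :=
  PadicInt p_pr (modpX_coherent (padic_mul_subproof x y)).

Lemma residue_lt x k : x k < p ^ k.
Proof. by rewrite -residue_small ltn_mod expn_gt0 prime_gt0. Qed.

Fact padic_opp_subproof x k :
  p ^ k - x k = p ^ k.+1 - x k.+1 %[mod p ^ k].
Proof.
apply/eqP; rewrite -(eqn_modDr (x k)) subnK ?(ltnW (residue_lt _ _)) // modnn.
rewrite [x k]residueP modnDmr subnK ?(ltnW (residue_lt _ _)) //.
by rewrite eq_sym; apply: dvdn_exp2l.
Qed.
Definition padic_opp x : padic_int p_pr :=
  PadicInt p_pr (modpX_coherent (padic_opp_subproof x)).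

Fact padic_addA : associative padic_add.
Proof. by move=> x y z; apply: padic_eqP => k /=; rewrite modnDml modnDmr addnA. Qed.
Fact padic_addC : commutative padic_add.
Proof. by move=> x y; apply: padic_eqP => k /=; rewrite addnC. Qed.
Fact padic_add0 : left_id (padic_nat 0) padic_add.
Proof. by move=> x; apply: padic_eqP => k /=; rewrite mod0n add0n residue_small. Qed.
Fact padic_addN : left_inverse (padic_nat 0) padic_opp padic_add.
Proof.
move=> x; apply: padic_eqP => k /=.
by rewrite modnDml subnK ?(ltnW (residue_lt _ _)) // modnn mod0n.
Qed.
HB.instance Definition _ := GRing.isZmodule.Build (padic_int p_pr)
  padic_addA padic_addC padic_add0 padic_addN.

Fact padic_mulA : associative padic_mul.
Proof. by move=> x y z; apply: padic_eqP => k /=; rewrite modnMml modnMmr mulnA. Qed.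
Fact padic_mulC : commutative padic_mul.
Proof. by move=> x y; apply: padic_eqP => k /=; rewrite mulnC. Qed.
Fact padic_mul1 : left_id (padic_nat 1) padic_mul.
Proof. by move=> x; apply: padic_eqP => k /=; rewrite modnMml mul1n residue_small. Qed.
Fact padic_mulDl : left_distributive padic_mul padic_add.
Proof.
by move=> x y z; apply: padic_eqP => k /=; rewrite modnMml modnDm mulnDl.
Qed.
Fact padic_one_neq0 : padic_nat 1 != 0%R.
Proof.
apply/eqP => /(congr1 (fun x : padic_int p_pr => x 1)) /=.
by rewrite expn1 mod0n modn_small ?prime_gt1.
Qed.
HB.instance Definition _ := GRing.Zmodule_isComNzRing.Build (padic_int p_pr)
  padic_mulA padic_mulC padic_mul1 padic_mulDl padic_one_neq0.

Local Open Scope ring_scope.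

Definition padic_unit : pred (padic_int p_pr) :=
  fun x => `[< exists y : padic_int p_pr, y * x = 1 >].
Definition padic_inv x : padic_int p_pr :=
  if pselect (exists y : padic_int p_pr, y * x = 1) is left ex
  then projT1 (cid ex) else x.

Fact padic_mulVr : {in padic_unit, left_inverse 1 padic_inv *%R}.
Proof.
move=> x /asboolP ux; rewrite /padic_inv; case: pselect => // ex.
by case: (cid ex).
Qed.
Fact padic_unitP x y : y * x = 1 -> padic_unit x.
Proof. by move=> yx1; apply/asboolP; exists y. Qed.
Fact padic_inv_out : {in [predC padic_unit], padic_inv =1 id}.
Proof.
by move=> x /asboolP nux; rewrite /padic_inv; case: pselect.
Qed.
HB.instance Definition _ := GRing.ComNzRing_hasMulInverse.Build (padic_int p_pr)
  padic_mulVr padic_unitP padic_inv_out.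

Fact padic_mulf_eq0 x y : x * y = 0 -> (x == 0) || (y == 0).
Proof.
move=> xy0; apply/norP => -[x_neq0 y_neq0].
have nz z : z != 0 -> exists k, z k != 0%N.
  move=> z_neq0; apply: contrapT => nex; move/eqP: z_neq0; apply.
  apply: padic_eqP => k /=; rewrite mod0n; apply: contrapT => /eqP zk.
  by apply: nex; exists k.
have [i xi] := nz _ x_neq0; have [j yj] := nz _ y_neq0.
have big z k l : (k <= l)%N -> z k != 0%N -> (0 < z l)%N /\ (logn p (z l) < k)%N.
  move=> le_kl; rewrite -(residue_mod z le_kl) => zk.
  have zl : (0 < z l)%N by rewrite lt0n; apply: contraNneq zk => ->; rewrite mod0n.
  by split=> //; rewrite ltnNge -pfactor_dvdn.
have [x_gt0 xlog] := big x _ _ (leq_addr j i) xi.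
have [y_gt0 ylog] := big y _ _ (leq_addl i j) yj.
have := congr1 (fun z : padic_int p_pr => z (i + j)%N) xy0; rewrite /= mod0n.
move/eqP; rewrite -/(dvdn _ _) pfactor_dvdn ?muln_gt0 ?x_gt0 // lognM //.
by rewrite leqNgt -addSn leq_add // ltnW.
Qed.
HB.instance Definition _ := GRing.ComUnitRing_isIntegral.Build (padic_int p_pr)
  padic_mulf_eq0.

End PadicInt.

Definition padic (p : nat) (p_pr : prime p) : fieldType :=
  {fraction padic_int p_pr}.

Local Open Scope ring_scope.
Local Open Scope classical_set_scope.

Inductive place := Infinite | Finite p of prime p.

Definition completion (R : realType) (v : place) : fieldType :=
  match v with
  | Infinite => R
  | Finite _ p_pr => padic p_pr
  end.

(* The curve y^2 = x^3 + A x^2 + B x; nonsingularity, i.e. badness E != 0,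
   is not part of the structure. *)
Record curve := Curve { coefA : int; coefB : int }.

Definition isogenous (E : curve) : curve :=
  Curve (- 2 * coefA E) (coefA E ^+ 2 - 4 * coefB E).

Definition badness (E : curve) : int :=
  coefB E ^+ 2 * (coefA E ^+ 2 - 4 * coefB E).

Inductive point (K : Type) := Origin | Affine of K & K.
Arguments Origin {K}.

Definition points (E : curve) (K : fieldType) : set (point K) :=
  [set P | match P with
           | Origin => True
           | Affine x y =>
               y ^+ 2 = x ^+ 3 + (coefA E)%:~R * x ^+ 2 + (coefB E)%:~R * x
           end].
Arguments points : clear implicits.

(* For a != 0, the class of a in K^* / K^*2, as a coset. *)
Definition sqclass (K : fieldType) (a : K) : set K :=
  [set a * u ^+ 2 | u in [set u : K | u != 0]].

(* On E this is delta'; on isogenous E, whose last coefficient is A^2 - 4B,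
   it is delta. A point with x = 0 is (0, 0). *)
Definition descent_map (E : curve) (K : fieldType) (P : point K) : set K :=
  match P with
  | Origin => sqclass 1
  | Affine x _ => sqclass (if x == 0 then (coefB E)%:~R else x)
  end.

Definition descent_image (E : curve) (K : fieldType) : set (set K) :=
  [set descent_map E P | P in points E K].
Arguments descent_image : clear implicits.

Definition bad_places (E : curve) : set place :=
  [set v | match v with
           | Infinite => True
           | Finite p _ => (p %| badness E)%Z
           end].

(* The square-free representatives of the subgroup of Q^* / Q^*2 generated by
   -1 and the primes dividing badness E. *)
Definition bad_sqfree (E : curve) : set int :=
  [set d | forall p : nat, prime p ->
     ~~ (p%:Z ^+ 2 %| d)%Z /\ ((p %| d)%Z -> (p %| badness E)%Z)].

Definition Selmer (R : realType) (E : curve) : set int :=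
  [set d | bad_sqfree E d /\ forall v, bad_places E v ->
     descent_image (isogenous E) (completion R v) (sqclass d%:~R)].

Definition Selmer' (R : realType) (E : curve) : set int :=
  [set d | bad_sqfree E d /\ forall v, bad_places E v ->
     descent_image E (completion R v) (sqclass d%:~R)].

Definition curve_pi3 (n : nat) : curve := Curve (2 * n%:Z) (- 3 * n%:Z ^+ 2).

Definition legendre (a : int) (p : nat) : int :=
  if (p %| a)%Z then 0
  else if [exists x : 'I_p, (x%:Z ^+ 2 == a %[mod p])%Z] then 1 else -1.

Record digraph := Digraph { vertices : {fset int}; arc : rel int }.

Definition residue_graph (m : int) : digraph :=
  Digraph
    [fset v in (if m < 0 then [:: -1] else [::]) ++
               [seq r%:Z | r <- primes `|m|%N]]%fset
    (fun r v => [&& r != v, 0 < r, (r == 1 %[mod 3])%Z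
                  & legendre v `|r|%N == -1]).

Definition nontrivial_partition (G : digraph) (V1 V2 : {fset int}) : Prop :=
  [/\ V1 != fset0, V2 != fset0, [disjoint V1 & V2]%fset
    & (V1 `|` V2)%fset = vertices G].

Definition arcs_into (G : digraph) (v : int) (W : {fset int}) : nat :=
  #|` [fset w in W | arc G v w]%fset |.

Definition odd_partition (G : digraph) (V1 V2 : {fset int}) : Prop :=
  (exists2 v, v \in V1 & odd (arcs_into G v V2)) \/
  (exists2 v, v \in V2 & odd (arcs_into G v V1)).

Definition odd_graph (G : digraph) : Prop :=
  forall V1 V2, nontrivial_partition G V1 V2 -> odd_partition G V1 V2.

Definition vertex_prod (V : {fset int}) : int := \prod_(v <- V) v.

(* Main.v *)
(* Put [x = n t] on [E] and [x = 4 n t] on the isogenous curve. Splitting the points of a curve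
   over [Q_p] according to whether [t] has zero, positive or negative valuation shows that the
   local images are generated by the torsion points: for an odd prime [p] dividing [n] they are
   the subgroup [<n, -3>] of [Q_p^* / Q_p^*2] for [E], and [<- n>] or [1] for the isogenous curve
   according to whether [-3] belongs to [<n>] or not. As [<n>] has index two, [d] in [S'(E)] becomes
   the condition [d \in <n>] at the primes where [-3] belongs to [<n>], that is at the [p_i], and
   at 3 if [n / 3 = 2 mod 3].

   A set of vertices of [G(m)] is the same thing as a divisor [d] of [m], with products in
   [Q^* / Q^*2] becoming symmetric differences, and the corresponding partition fails to be odd
   exactly when [d \in <m>] at each prime [p = 1 mod 3] dividing [m]. So a nontrivial partition that
   is not odd is a Selmer class which is neither trivial nor the class of [m]. Finally [s] is
   bounded by counting: the [2^(t+s)] divisors of [n / 3] meet one condition of index two at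
   each [p_i], and one more at 3 if [n / 3 = 2 mod 3]. *)

Require Import Defs.
From HB Require Import structures.
From mathcomp Require Import all_boot all_order all_algebra.
From mathcomp Require Import all_fingroup all_solvable finfield.
From mathcomp Require Import finmap.
From mathcomp Require Import boolp classical_sets reals.
From mathcomp Require Import zify ring.
(* [coefB] also names a lemma of poly.v. *)
Import Defs.

Set Implicit Arguments.
Unset Strict Implicit.
Unset Printing Implicit Defensive.

Import Order.TTheory GRing.Theory Num.Theory.

Local Open Scope ring_scope.
Local Open Scope classical_set_scope.

(** * Squares *)

Definition is_square (A : nzRingType) (x : A) : Prop := exists y, x = y ^+ 2.

Section SquaresInRings.
Variable A : comNzRingType.
Implicit Types x y : A.

Lemma is_square_sqr x : is_square (x ^+ 2).
Proof. by exists x. Qed.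

Lemma is_square1 : is_square (1 : A).
Proof. by exists 1; rewrite expr1n. Qed.

Lemma is_squareM x y : is_square x -> is_square y -> is_square (x * y).
Proof. by move=> [u ->] [v ->]; exists (u * v); rewrite exprMn. Qed.

Lemma rmorph_is_square (B : nzRingType) (f : {rmorphism A -> B}) x :
  is_square x -> is_square (f x).
Proof. by move=> [y ->]; exists (f y); rewrite rmorphXn. Qed.

End SquaresInRings.

Section SquaresInFields.
Variable K : fieldType.
Implicit Types a b c e x y w : K.

Lemma is_square_cancel e x : e != 0 -> is_square (x * e ^+ 2) -> is_square x.
Proof.
by move=> e0 [y yE]; exists (y / e); rewrite expr_div_n -yE mulfK // expf_neq0.
Qed.

Lemma is_square_mul_eq e x a b :
  e != 0 -> is_square a -> is_square b -> a * b = x * e ^+ 2 -> is_square x.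
Proof. by move=> e0 sa sb abE; apply: (is_square_cancel e0); rewrite -abE; exact: is_squareM. Qed.

Lemma is_square_mulr x y : y != 0 -> is_square y -> is_square (x * y) -> is_square x.
Proof. by move=> y0 sy sxy; apply: (is_square_mul_eq y0 sxy sy); ring. Qed.

Lemma sqclass_eqP a b : a != 0 -> b != 0 -> sqclass a = sqclass b <-> is_square (a * b).
Proof.
move=> a0 b0; split=> [ab|].
  have : sqclass b b by exists 1; rewrite /= ?oner_neq0 // expr1n mulr1.
  by rewrite -ab => -[u /= _ <-]; exists (a * u); ring.
have sub x y : x != 0 -> y != 0 -> is_square (x * y) -> sqclass x `<=` sqclass y.
  move=> x0 y0 [u uE] _ [v v0 <-]; exists (u / y * v).
    by rewrite /= !mulf_neq0 ?invr_eq0 // -sqrf_eq0 -uE mulf_neq0.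
  by rewrite exprMn expr_div_n -uE; field.
by move=> sab; apply/seteqP; split; apply: sub => //; rewrite mulrC.
Qed.

Lemma is_square_N3 : 2 != 0 :> K -> is_square (-3 : K) <-> exists w, w ^+ 2 + w + 1 = 0.
Proof.
move=> two; split=> [[r rE]|[w wE]].
  exists ((r - 1) / 2).
  have -> : ((r - 1) / 2) ^+ 2 + (r - 1) / 2 + 1 = (r ^+ 2 + 3) / 4.
    by field; rewrite (_ : 4 = 2 * 2) ?mulf_neq0 //; ring.
  by rewrite -rE addNr mul0r.
exists (2 * w + 1); have -> : (2 * w + 1) ^+ 2 = 4 * (w ^+ 2 + w + 1) - 3 by ring.
by rewrite wE; ring.
Qed.

(* The membership of [x] in the subgroup of [K^* / K^*2] generated by [c]. *)
Definition sqspan c x : Prop := is_square x \/ is_square (c * x).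

Lemma sqspan1 c : sqspan c 1.
Proof. by left; exact: is_square1. Qed.

Lemma sqspan_id c : sqspan c c.
Proof. by right; rewrite -expr2; exact: is_square_sqr. Qed.

Lemma sqspanM c x y : c != 0 -> sqspan c x -> sqspan c y -> sqspan c (x * y).
Proof.
move=> c0 [sx|scx] [sy|scy]; [left|right|right|left].
- exact: is_squareM.
- by rewrite mulrCA; exact: is_squareM.
- by rewrite mulrA; exact: is_squareM.
- by apply: (is_square_mul_eq c0 scx scy); ring.
Qed.

Lemma sqspan_cancel c e x : e != 0 -> sqspan c (x * e ^+ 2) -> sqspan c x.
Proof.
by move=> e0 [s|s]; [left|right]; apply: (is_square_cancel e0); rewrite -?mulrA.
Qed.

Lemma sqspan_gen_mul c e x : e != 0 -> is_square e -> sqspan (c * e) x <-> sqspan c x.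
Proof.
move=> e0 se; split=> -[s|s]; [by left|right|by left|right].
  by apply: (is_square_mul_eq e0 s se); ring.
by rewrite mulrAC; exact: is_squareM.
Qed.

End SquaresInFields.

Section SquaresInFiniteFields.
Variable F : finFieldType.
Implicit Types a b w : F.

Lemma nonsquare_mul a b : a != 0 -> b != 0 ->
  ~ is_square a -> ~ is_square b -> is_square (a * b).
Proof.
have [g gP] := cyclicP (field_unit_group_cyclic [group of [set: {unit F}]]).
have powP c : c != 0 -> exists i, c = val g ^+ i.
  rewrite -unitfE => c_unit; have: FinRing.unit F c_unit \in <[g]>%g by rewrite -gP inE.
  by case/cycleP=> i /(congr1 val) /=; rewrite FinRing.val_unitX => ->; exists i.
have even_square i : ~~ odd i -> is_square (val g ^+ i).
  by move=> i_even; exists (val g ^+ i./2); rewrite -exprM muln2 even_halfK.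
have nonsquare_odd i : ~ is_square (val g ^+ i) -> odd i.
  by move=> nsq; apply/negPn/negP => /even_square.
move=> /powP [i ->] /powP [j ->] /nonsquare_odd i_odd /nonsquare_odd j_odd.
by rewrite -exprD; apply: even_square; rewrite oddD i_odd j_odd.
Qed.

Lemma is_square_mulE a b : a != 0 -> b != 0 ->
  `[< is_square (a * b) >] = (`[< is_square a >] == `[< is_square b >]).
Proof.
move=> a0 b0; case: (asboolP (is_square a)) => sa; case: (asboolP (is_square b)) => sb.
- by rewrite asboolT //; exact: is_squareM.
- by rewrite asboolF // => sab; apply: sb; apply: is_square_mulr a0 sa _; rewrite mulrC.
- by rewrite asboolF // => /(is_square_mulr b0 sb).
- by rewrite asboolT //; exact: nonsquare_mul.
Qed.

Lemma cube_root_unityP : 3 != 0 :> F ->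
  (exists w, w ^+ 2 + w + 1 = 0) <-> (3 %| #|F|.-1)%N.
Proof.
move=> three; have cube w : w ^+ 3 - 1 = (w - 1) * (w ^+ 2 + w + 1) by ring.
rewrite -card_finField_unit; split=> [[w w0]|/(Cauchy (isT : prime 3)) [g _ g_order]].
  have w3 : w ^+ 3 = 1 by apply/eqP; rewrite -subr_eq0 cube w0 mulr0.
  have w_neq0 : w != 0 by apply: contra_eqN w3 => /eqP ->; rewrite expr0n eq_sym oner_eq0.
  have w_unit : w \is a GRing.unit by rewrite unitfE.
  set g : {unit F} := FinRing.unit F w_unit.
  have g_order : #[g]%g = 3%N.
    apply/(prime_nt_dvdP (isT : prime 3)); last first.
      by rewrite order_dvdn; apply/eqP/val_inj; rewrite FinRing.val_unitX /= w3.
    rewrite order_eq1; apply: contraNneq three => /(congr1 val) /= w1.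
    by rewrite -w0 w1 expr1n; apply/eqP; ring.
  by rewrite -g_order order_dvdG // inE.
exists (val g); have /(congr1 val) := expg_order g.
rewrite g_order FinRing.val_unitX /= => /eqP; rewrite -subr_eq0 cube mulf_eq0.
case/orP=> /eqP // /eqP; rewrite subr_eq0 => /eqP g1.
have : g = 1%g by apply: val_inj.
by move/eqP; rewrite -order_eq1 g_order.
Qed.

End SquaresInFiniteFields.

(** * The ring of p-adic integers *)

Lemma intr_Fp_eq0 (p : nat) (a : int) : prime p -> (a%:~R == 0 :> 'F_p) = (p %| a)%Z.
Proof.
move=> p_pr; rewrite dvdzE absz_nat (dvdn_pcharf (pchar_Fp p_pr)).
by case: a => k; rewrite ?NegzE ?abszN ?mulrNz ?oppr_eq0.
Qed.

Section PadicInt.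
Variables (p : nat) (p_pr : prime p).
Local Notation Zp := (padic_int p_pr).
Implicit Types (x y z u : Zp) (k : nat).

Lemma residueD x y k : (x + y) k = ((x k + y k) %% p ^ k)%N.
Proof. by []. Qed.

Lemma residueM x y k : (x * y) k = ((x k * y k) %% p ^ k)%N.
Proof. by []. Qed.

Lemma residue_nat (n k : nat) : (n%:R : Zp) k = (n %% p ^ k)%N.
Proof.
elim: n => [|n IHn] /=; first by rewrite mod0n.
by rewrite mulrS residueD IHn modnDm add1n.
Qed.

Lemma residue_at0 x : x 0%N = 0%N.
Proof. by rewrite -[x 0%N]residue_small expn0 modn1. Qed.

Lemma residue_pmul x k : (p%:R * x) k.+1 = (p * x k)%N.
Proof.
by rewrite residueM residue_nat modnMml [x k]residueP muln_modr expnS.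
Qed.

Lemma residue_eq0 x k : x k = 0%N <-> exists y, x = p%:R ^+ k * y.
Proof.
have pXE : (p%:R : Zp) ^+ k = (p ^ k)%:R by rewrite natrX.
split=> [xk|[y ->]]; last by rewrite pXE residueM residue_nat modnn mul0n mod0n.
have quotient_coherent j : (x (j + k) %/ p ^ k = x (j.+1 + k) %/ p ^ k %[mod p ^ j])%N.
  by rewrite !modn_divl -!expnD -[in LHS](residue_mod x (leqnSn (j + k))) modn_mod.
exists (PadicInt p_pr (modpX_coherent quotient_coherent)); rewrite pXE.
apply: padic_eqP => j; rewrite residueM residue_nat modnMml /= modnMmr mulnC divnK.
  by rewrite residue_mod ?leq_addr.
by rewrite /dvdn residue_mod ?leq_addl // xk.
Qed.

(* A map that is compatible with all congruences becomes a contraction after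
   multiplication by [p]. *)
Lemma padic_fixpoint (G : Zp -> Zp) z :
  (forall x y k, x k = y k -> G x k = G y k) -> exists w, w = z + p%:R * G w.
Proof.
move=> G_cong; pose F w := z + p%:R * G w; pose w_ k := iter k F 0.
have F_contract x y k : x k = y k -> F x k.+1 = F y k.+1.
  by move=> xy; rewrite !residueD !residue_pmul (G_cong _ _ _ xy).
have w_S k : w_ k.+1 k = w_ k k.
  by elim: k => [|k IHk]; [rewrite !residue_at0|apply: F_contract].
have w_coherent k : w_ k k = (w_ k.+1 k.+1 %% p ^ k)%N by rewrite residue_mod ?w_S.
exists (PadicInt p_pr w_coherent); apply: padic_eqP => k.
rewrite residueD residueM (G_cong _ (w_ k)) // -residueM -residueD.
exact/esym/w_S.
Qed.

Section ResidueMap.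
Variables (A : nzRingType) (k : nat).
Hypothesis natr_eq0_dvd : forall i : nat, (i%:R == 0 :> A) = (p ^ k %| i)%N.

(* The dummy argument carries the hypothesis to the morphism instances below. *)
Definition residue_map of (forall i : nat, (i%:R == 0 :> A) = (p ^ k %| i)%N) :=
  fun x => (x k)%:R : A.
Local Notation red := (residue_map natr_eq0_dvd).

Lemma natr_modX (i : nat) : (i %% p ^ k)%:R = i%:R :> A.
Proof.
have /eqP pk0 : (p ^ k)%:R == 0 :> A by rewrite natr_eq0_dvd.
by rewrite [in RHS](divn_eq i (p ^ k)) natrD natrM pk0 mulr0 add0r.
Qed.

Fact residue_map_zmod_morphism : zmod_morphism red.
Proof.
have redD x y : red (x + y) = red x + red y.
  by rewrite /residue_map residueD natr_modX natrD.
by move=> x y; apply: (addIr (red y)); rewrite -redD !subrK.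
Qed.

Fact residue_map_monoid_morphism : monoid_morphism red.
Proof.
split; first by rewrite /residue_map -[1 : Zp]/(1%:R) residue_nat natr_modX.
by move=> x y; rewrite /residue_map residueM natr_modX natrM.
Qed.

HB.instance Definition _ := GRing.isZmodMorphism.Build Zp A red residue_map_zmod_morphism.
HB.instance Definition _ := GRing.isMonoidMorphism.Build Zp A red residue_map_monoid_morphism.

Lemma residue_map_eq0 x : red x = 0 <-> exists y, x = p%:R ^+ k * y.
Proof.
rewrite -residue_eq0; split=> [/eqP|xk]; last by rewrite /residue_map xk.
by rewrite natr_eq0_dvd /dvdn residue_small => /eqP.
Qed.

End ResidueMap.

Fact natr_Fp_eq0 (i : nat) : (i%:R == 0 :> 'F_p) = (p ^ 1 %| i)%N.
Proof. by rewrite expn1 (dvdn_pcharf (pchar_Fp p_pr)). Qed.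

Definition red_Fp : {rmorphism Zp -> 'F_p} := residue_map natr_Fp_eq0.

Lemma red_Fp_eq0 x : red_Fp x = 0 <-> exists y, x = p%:R * y.
Proof. exact: (residue_map_eq0 natr_Fp_eq0). Qed.

Lemma red_Fp_surj (a : 'F_p) : red_Fp (a : nat)%:R = a.
Proof. by rewrite rmorph_nat natr_Zp. Qed.

Lemma red_Fp_p : red_Fp p%:R = 0.
Proof. by rewrite rmorph_nat pchar_Fp_0. Qed.

Lemma padic_intr_eq0 (c : int) : (c%:~R == 0 :> Zp) = (c == 0).
Proof.
have natr_eq0 (i : nat) : (i%:R == 0 :> Zp) = (i == 0%N).
  apply/eqP/eqP => [i0|->//]; have := residue_nat i i.
  by rewrite i0 [LHS]mod0n modn_small // ltn_expl // prime_gt1.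
by case: c => i; rewrite ?NegzE ?mulrNz ?oppr_eq0 natr_eq0.
Qed.

Lemma padic_p_neq0 : p%:R != 0 :> Zp.
Proof. by rewrite -[p%:R]/(p%:~R) padic_intr_eq0; have := prime_gt0 p_pr; lia. Qed.

Lemma padic_unitE x : (x \is a GRing.unit) = (red_Fp x != 0).
Proof.
apply/idP/idP => [x_unit|x_red]; first by rewrite -unitfE rmorph_unit.
pose c : Zp := ((red_Fp x)^-1 : nat)%:R.
have /red_Fp_eq0 [e eE] : red_Fp (1 - c * x) = 0.
  by rewrite rmorphB rmorphM rmorph1 /= red_Fp_surj mulVf ?subrr.
have [w wE] : exists w, w = 1 + p%:R * (e * w).
  by apply: padic_fixpoint => y z k yz; rewrite !residueM yz.
have cwx : c * w * x = 1.
  rewrite mulrAC -[c * x](subKr 1) eE mulrBl mul1r -mulrA.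
  by rewrite [X in X - _]wE addrK.
by apply/unitrP; exists (c * w); split=> //; rewrite mulrC.
Qed.

(* [1 + 2 p w] is a root of [1 + 4 p z] when [w = z - p w^2]; the factor 4 makes
   Hensel's lemma uniform in [p]. *)
Lemma is_square_1D4p z : is_square (1 + 4 * p%:R * z).
Proof.
have [w wE] : exists w, w = z + p%:R * (-1 * (w * w)).
  by apply: padic_fixpoint => x y k xy; rewrite !residueM xy.
exists (1 + 2 * p%:R * w); rewrite [RHS](_ : _ = 1 + 4 * p%:R * (w + p%:R * (w * w))).
  by rewrite {1}wE mulN1r mulrN subrK.
by ring.
Qed.

Lemma padic_int_factor x : x != 0 -> exists k u, u \is a GRing.unit /\ x = p%:R ^+ k * u.
Proof.
move=> x0; have [k xk] : exists k, x k != 0%N.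
  apply: contrapT => x_res; move/eqP: x0; apply; apply: padic_eqP => k.
  by rewrite [RHS]mod0n; apply: contrapT => /eqP xk; apply: x_res; exists k.
elim: k x x0 xk => [|k IHk] x x0 xk; first by rewrite residue_at0 in xk.
have [x_unit|] := boolP (x \is a GRing.unit); first by exists 0%N, x; rewrite mul1r.
rewrite padic_unitE negbK => /eqP /red_Fp_eq0 [y xE]; move: x0 xk; rewrite {x}xE.
rewrite mulf_eq0 negb_or residue_pmul muln_eq0 => /andP [_ y0] /norP [_ yk].
have [j [u [u_unit ->]]] := IHk y y0 yk.
by exists j.+1, u; rewrite exprS mulrA.
Qed.

End PadicInt.
Arguments red_Fp : simpl never.

(** * The field of p-adic numbers *)

Lemma fraction_div (A : idomainType) (x : {fraction A}) :
  exists a b : A, b != 0 /\ x * tofrac b = tofrac a.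
Proof.
elim/quotW: x => x; exists \n_x, \d_x; split; first exact: denom_ratioP.
rewrite -[_ * _]/(FracField.mul _ _) !piE /FracField.mulf.
rewrite !numden_Ratio ?oner_neq0 // mulr1; apply/eqmodP.
by rewrite /= FracField.equivfE !numden_Ratio ?oner_neq0 ?denom_ratioP // mulr1 mulrC.
Qed.

Definition Zp_to_Qp (p : nat) (p_pr : prime p) : {rmorphism padic_int p_pr -> padic p_pr} :=
  @tofrac (padic_int p_pr).
Arguments Zp_to_Qp : simpl never.

Local Notation "x %:Qp" := (Zp_to_Qp _ x).

Section PadicField.
Variables (p : nat) (p_pr : prime p).
Local Notation Zp := (padic_int p_pr).
Local Notation Qp := (padic p_pr).
Local Notation red := (red_Fp p_pr).
Implicit Types (x y : Qp) (a b u v : Zp) (c d : int).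

Lemma Zp_to_Qp_inj : injective (Zp_to_Qp p_pr).
Proof. by move=> a b /eqP; rewrite tofrac_eq => /eqP. Qed.

Lemma Zp_to_Qp_eq0 a : (a%:Qp == 0) = (a == 0).
Proof. exact: tofrac_eq0. Qed.

Lemma Zp_to_Qp_pXM k a : (p%:R ^+ k * a)%:Qp = p%:R ^+ k * a%:Qp.
Proof. by rewrite rmorphM rmorphXn rmorph_nat. Qed.

Lemma Zp_to_Qp_pM a : (p%:R * a)%:Qp = p%:R * a%:Qp.
Proof. exact: (Zp_to_Qp_pXM 1). Qed.

Lemma Qp_intr_eq0 c : (c%:~R == 0 :> Qp) = (c == 0).
Proof. by rewrite -(rmorph_int (Zp_to_Qp p_pr)) Zp_to_Qp_eq0 padic_intr_eq0. Qed.

Lemma Qp_nat_neq0 (i : nat) : (0 < i)%N -> i%:R != 0 :> Qp.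
Proof. by move=> i_gt0; rewrite -[i%:R]/(i%:~R) Qp_intr_eq0; lia. Qed.

Lemma Qp_p_neq0 : p%:R != 0 :> Qp.
Proof. exact/Qp_nat_neq0/prime_gt0. Qed.

Lemma unit_Zp_to_Qp_neq0 u : u \is a GRing.unit -> u%:Qp != 0.
Proof. by move=> u_unit; rewrite Zp_to_Qp_eq0; apply: contraTneq u_unit => ->; rewrite unitr0. Qed.

Lemma Qp_factor x : x != 0 ->
  exists k l u, u \is a GRing.unit /\ x * p%:R ^+ l = p%:R ^+ k * u%:Qp.
Proof.
move=> x0; have [a [b [b0 xbE]]] : exists a b, b != 0 /\ x * b%:Qp = a%:Qp := fraction_div x.
have a0 : a != 0 by rewrite -Zp_to_Qp_eq0 -xbE mulf_neq0 ?Zp_to_Qp_eq0.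
have [k [u [u_unit aE]]] := padic_int_factor a0.
have [l [v [v_unit bE]]] := padic_int_factor b0.
exists k, l, (u / v); split; first by rewrite unitrM u_unit unitrV.
apply: (mulIf (unit_Zp_to_Qp_neq0 v_unit)); rewrite -!mulrA -rmorphM divrK //.
by rewrite -[p%:R ^+ l * _]Zp_to_Qp_pXM -bE xbE aE; exact: Zp_to_Qp_pXM.
Qed.

Variant padic_spec x : Prop :=
| PadicUnit u of u \is a GRing.unit & x = u%:Qp
| PadicSmall a of x = p%:R * a%:Qp
| PadicLarge a of x * (p%:R * a%:Qp) = 1.

Lemma padicP x : padic_spec x.
Proof.
have [->|x0] := eqVneq x 0; first by apply: (PadicSmall (a := 0)); rewrite rmorph0 mulr0.
have [k [l [u [u_unit xE]]]] := Qp_factor x0.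
have pX_neq0 i : p%:R ^+ i != 0 :> Qp by rewrite expf_neq0 ?Qp_p_neq0.
have [kl|] := eqVneq k l.
  by apply: (PadicUnit u_unit); apply: (mulIf (pX_neq0 l)); rewrite xE kl mulrC.
rewrite neq_ltn => /orP [/subnK|/subnK]; rewrite addnS => klE.
  have xE' : x * p%:R ^+ (l - k.+1).+1 = u%:Qp.
    by apply: (mulIf (pX_neq0 k)); rewrite [RHS]mulrC -xE -[in RHS]klE !exprS exprD; ring.
  apply: (PadicLarge (a := p%:R ^+ (l - k.+1) * u^-1)).
  by rewrite Zp_to_Qp_pXM (mulrA p%:R) -exprS mulrA xE' -rmorphM divrr // rmorph1.
apply: (PadicSmall (a := p%:R ^+ (k - l.+1) * u)); apply: (mulIf (pX_neq0 l)).
by rewrite xE Zp_to_Qp_pXM -[in LHS]klE !exprS exprD; ring.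
Qed.

Lemma red_pM a : red (p%:R * a) = 0.
Proof. by rewrite rmorphM /= red_Fp_p mul0r. Qed.

Lemma is_square_Zp a : is_square (a%:Qp) -> is_square a.
Proof.
move=> [y yE]; case: (padicP y) => [u _ uE|b bE|b bE].
- by exists u; apply: Zp_to_Qp_inj; rewrite yE uE rmorphXn.
- by exists (p%:R * b); apply: Zp_to_Qp_inj; rewrite yE bE rmorphXn /= Zp_to_Qp_pM.
have : a * (p%:R * b) ^+ 2 = 1.
  by apply: Zp_to_Qp_inj; rewrite rmorphM rmorphXn /= Zp_to_Qp_pM yE -exprMn bE expr1n rmorph1.
move/(congr1 red)/eqP; rewrite rmorphM rmorphXn red_pM expr0n mulr0 rmorph1.
by rewrite eq_sym oner_eq0.
Qed.

Definition uniformizer (c : Qp) : Prop :=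
  exists2 v, v \is a GRing.unit & c = p%:R * v%:Qp.

Lemma uniformizer_neq0 (c : Qp) : uniformizer c -> c != 0.
Proof. by move=> [v v_unit ->]; rewrite mulf_neq0 ?Qp_p_neq0 ?unit_Zp_to_Qp_neq0. Qed.

Lemma uniformizerMunit (c : Qp) u : uniformizer c -> u \is a GRing.unit -> uniformizer (c * u%:Qp).
Proof.
by move=> [v v_unit ->] u_unit; exists (v * u); rewrite ?unitrM ?v_unit // rmorphM mulrA.
Qed.

Lemma uniformizer_nonsquare (c : Qp) : uniformizer c -> ~ is_square c.
Proof.
move=> [v v_unit ->]; rewrite -Zp_to_Qp_pM => /is_square_Zp [y yE].
have /red_Fp_eq0 [b bE] : red y = 0.
  by apply/eqP; rewrite -sqrf_eq0 -rmorphXn -yE red_pM.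
have vE : v = p%:R * b ^+ 2.
  by apply: (mulfI (padic_p_neq0 p_pr)); rewrite yE bE; ring.
by move: v_unit; rewrite padic_unitE vE red_pM eqxx.
Qed.

Lemma unit_intr d : ((d%:~R : Zp) \is a GRing.unit) = ~~ (p %| d)%Z.
Proof. by rewrite padic_unitE rmorph_int intr_Fp_eq0. Qed.

Lemma uniformizer_intr d : (p %| d)%Z -> ~~ (p%:Z ^+ 2 %| d)%Z -> uniformizer d%:~R.
Proof.
move=> /dvdzP [e ->]; have p_neq0 : p%:Z != 0 by have := prime_gt0 p_pr; lia.
rewrite expr2 dvdz_mul2r // => pe; exists e%:~R; first by rewrite unit_intr.
by rewrite rmorphM rmorph_int mulrC.
Qed.

Lemma Qp_sqclass x : x != 0 ->
  exists2 u, u \is a GRing.unit & is_square (x * u%:Qp) \/ is_square (p%:R * (x * u%:Qp)).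
Proof.
move=> x0; have [k [l [u [u_unit xE]]]] := Qp_factor x0; exists u => //.
have pl_neq0 : p%:R ^+ l != 0 :> Qp by rewrite expf_neq0 ?Qp_p_neq0.
have klE : (k + l = odd (k + l) + (k + l)./2.*2)%N by rewrite odd_double_half.
have xuE : x * u%:Qp * (p%:R ^+ l) ^+ 2 =
    p%:R ^+ odd (k + l) * (p%:R ^+ (k + l)./2 * u%:Qp) ^+ 2.
  transitivity (x * p%:R ^+ l * (u%:Qp * p%:R ^+ l)); first by ring.
  transitivity (p%:R ^+ (k + l) * u%:Qp ^+ 2); first by rewrite xE exprD; ring.
  by rewrite [in LHS]klE exprD -muln2 exprM; ring.
case: (odd _) xuE => xuE; [right|left]; apply: (is_square_cancel pl_neq0).
  by exists (p%:R * (p%:R ^+ (k + l)./2 * u%:Qp)); rewrite -mulrA xuE; ring.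
by exists (p%:R ^+ (k + l)./2 * u%:Qp); rewrite xuE mul1r.
Qed.

Section OddPrime.
Hypothesis p_odd : odd p.

Lemma red_nat_neq0 (i : nat) : prime i -> i != p -> red i%:R != 0.
Proof.
move=> i_pr ip; rewrite rmorph_nat (natr_Fp_eq0 p_pr) expn1.
by rewrite dvdn_prime2 // eq_sym.
Qed.

Lemma is_square_unit u : u \is a GRing.unit -> is_square u%:Qp <-> is_square (red u).
Proof.
move=> u_unit; split=> [/is_square_Zp|[a aE]]; first exact: rmorph_is_square.
pose v : Zp := (a : nat)%:R; have vE : red v = a := red_Fp_surj p_pr a.
have /red_Fp_eq0 [y yE] : red (u - v ^+ 2) = 0.
  by rewrite rmorphB rmorphXn vE aE subrr.
have w_unit : 4 * v ^+ 2 \is a GRing.unit.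
  have two_unit : (2 : Zp) \is a GRing.unit.
    by rewrite padic_unitE red_nat_neq0 //; apply: contraTneq p_odd => <-.
  rewrite (_ : 4 = 2 * 2); last by ring.
  have v_unit : v \is a GRing.unit by rewrite padic_unitE vE -sqrf_eq0 -aE -padic_unitE.
  by rewrite !unitrM two_unit v_unit.
have -> : u = v ^+ 2 * (1 + 4 * p%:R * (y / (4 * v ^+ 2))).
  rewrite mulrDr mulr1 (_ : _ * (4 * _ * _) = p%:R * (y / (4 * v ^+ 2) * (4 * v ^+ 2))).
    by rewrite divrK // -yE; ring.
  by ring.
apply: rmorph_is_square; apply: is_squareM; first exact: is_square_sqr.
exact: is_square_1D4p.
Qed.

Section Sqspan.
Variable c : Qp.
Hypothesis c_unif : uniformizer c.

Lemma sqspan_unit u : u \is a GRing.unit -> sqspan c u%:Qp <-> is_square (red u).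
Proof.
move=> u_unit; rewrite -is_square_unit //; split=> [[//|]|]; last by left.
by move/(uniformizer_nonsquare (uniformizerMunit c_unif u_unit)).
Qed.

Lemma sqspan_unit_representative x : x != 0 ->
  exists2 u, u \is a GRing.unit & sqspan c (x * u%:Qp).
Proof.
move=> /Qp_sqclass [u u_unit [xu|pxu]]; first by exists u; [|left].
have [v v_unit cE] := c_unif; exists (u * v); first by rewrite unitrM u_unit.
right; rewrite cE rmorphM (_ : _ * _ = p%:R * (x * u%:Qp) * v%:Qp ^+ 2).
  by apply: is_squareM => //; exact: is_square_sqr.
by ring.
Qed.

Lemma sqspan_index2 x y : x != 0 -> y != 0 ->
  ~ sqspan c x -> ~ sqspan c y -> sqspan c (x * y).
Proof.
have c0 := uniformizer_neq0 c_unif.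
have nonsquare_rep z : z != 0 -> ~ sqspan c z ->
    exists u, [/\ u \is a GRing.unit, ~ is_square (red u) & sqspan c (z * u%:Qp)].
  move=> /sqspan_unit_representative [u u_unit zu] nz; exists u; split=> //.
  move=> /(sqspan_unit u_unit) su; apply: nz.
  apply: (sqspan_cancel (unit_Zp_to_Qp_neq0 u_unit)).
  by rewrite expr2 mulrA; exact: sqspanM.
move=> x0 y0 /(nonsquare_rep _ x0) [u [u_unit nu xu]] /(nonsquare_rep _ y0) [v [v_unit nv yv]].
have uv_unit : u * v \is a GRing.unit by rewrite unitrM u_unit.
apply: (sqspan_cancel (unit_Zp_to_Qp_neq0 uv_unit)).
have -> : x * y * (u * v)%:Qp ^+ 2 = x * u%:Qp * (y * v%:Qp) * (u * v)%:Qp by rewrite rmorphM; ring.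
apply: sqspanM (sqspanM _ xu yv) _ => //; apply/(sqspan_unit uv_unit).
by rewrite rmorphM; apply: nonsquare_mul; rewrite -?padic_unitE.
Qed.

Lemma sqspan_twist e x : e != 0 -> x != 0 ->
  sqspan c x \/ sqspan c (e * x) <-> (sqspan c e -> sqspan c x).
Proof.
move=> e0 x0; have c0 := uniformizer_neq0 c_unif; split=> [[//|ex] ce|ce_cx].
  by apply: (sqspan_cancel e0); rewrite expr2 mulrA [x * e]mulrC; exact: sqspanM.
have [cx|ncx] := pselect (sqspan c x); [by left|right].
by apply: sqspan_index2 => // ce; apply/ncx/ce_cx.
Qed.

End Sqspan.

Lemma is_square_intr d : ~~ (p %| d)%Z ->
  is_square (d%:~R : Qp) <-> is_square (d%:~R : 'F_p).
Proof.
move=> pd; rewrite -(rmorph_int (Zp_to_Qp p_pr)) -(rmorph_int red).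
by apply: is_square_unit; rewrite unit_intr.
Qed.

Lemma sqspan_cofactor c d : (p %| c * d)%Z -> ~~ (p%:Z ^+ 2 %| c * d)%Z ->
  sqspan ((c * d)%:~R : Qp) c%:~R <->
  if (p %| c)%Z then is_square (d%:~R : 'F_p) else is_square (c%:~R : 'F_p).
Proof.
move=> pcd p2cd; have cd_unif := uniformizer_intr pcd p2cd.
case: ifPn => pc; last first.
  rewrite -[X in sqspan _ X](rmorph_int (Zp_to_Qp p_pr)) -(rmorph_int red).
  by apply: sqspan_unit; rewrite ?unit_intr.
have pd : ~~ (p %| d)%Z.
  by apply: contra p2cd => pd; rewrite expr2 dvdz_mul.
have c0 : c%:~R != 0 :> Qp.
  by have := uniformizer_neq0 cd_unif; rewrite rmorphM mulf_eq0 negb_or => /andP [].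
have c_unif : uniformizer c%:~R.
  by apply: uniformizer_intr => //; apply: contra p2cd => p2c; exact: dvdz_mulr.
have cdcE : (c * d)%:~R * c%:~R = d%:~R * c%:~R ^+ 2 :> Qp by rewrite rmorphM; ring.
rewrite -is_square_intr //; split=> [[/(uniformizer_nonsquare c_unif)//|]|sd].
  by rewrite cdcE; exact: is_square_cancel.
by right; rewrite cdcE; apply: is_squareM => //; exact: is_square_sqr.
Qed.

End OddPrime.
End PadicField.

Section Dyadic.
Variable p_pr : prime 2.
Local Notation Z2 := (padic_int p_pr).
Implicit Types u v : Z2.

Fact natr_Z8_eq0 (i : nat) : (i%:R == 0 :> 'Z_8) = (2 ^ 3 %| i)%N.
Proof. by rewrite Zp_nat -val_eqE. Qed.

Definition red_Z8 : {rmorphism Z2 -> 'Z_8} := residue_map (k := 3) natr_Z8_eq0.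

Lemma red_Z8_eq0 u : red_Z8 u = 0 <-> exists v, u = 8 * v.
Proof.
rewrite (residue_map_eq0 natr_Z8_eq0) (_ : 2%:R ^+ 3 = 8 :> Z2) //; ring.
Qed.

Lemma sqr_unit_Z8 (a : 'Z_8) : a \is a GRing.unit -> a ^+ 2 = 1.
Proof. by case: a => -[|[|[|[|[|[|[|[|//]]]]]]]] a_lt8 //= _; exact: val_inj. Qed.

Lemma red_Z8_eq1_is_square u : red_Z8 u = 1 -> is_square (Zp_to_Qp p_pr u).
Proof.
move=> u1; have /red_Z8_eq0 [v vE] : red_Z8 (u - 1) = 0 by rewrite rmorphB u1 rmorph1 subrr.
apply: rmorph_is_square; have -> : u = 1 + 4 * 2%:R * v by rewrite -[LHS](subrK 1) vE; ring.
exact: is_square_1D4p.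
Qed.

Lemma is_square_red_Z8_eq1 u : u \is a GRing.unit -> is_square (Zp_to_Qp p_pr u) -> red_Z8 u = 1.
Proof.
move=> u_unit /is_square_Zp [v vE]; rewrite vE rmorphXn; apply: sqr_unit_Z8.
by apply: rmorph_unit; move: u_unit; rewrite vE unitrX_pos.
Qed.

Lemma is_square_intr_Z8 (e : int) : e%:~R = 1 :> 'Z_8 -> is_square (e%:~R : padic p_pr).
Proof.
by rewrite -(rmorph_int red_Z8) -(rmorph_int (Zp_to_Qp p_pr)); exact: red_Z8_eq1_is_square.
Qed.

End Dyadic.
Arguments red_Z8 : simpl never.

(** * Local images of the descent maps *)

Section DescentImage.
Variable K : fieldType.
Implicit Types d t x : K.

Lemma descent_imageP (E : curve) d : d != 0 -> (coefB E)%:~R != 0 :> K ->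
  descent_image E K (sqclass d) <->
  [\/ is_square d, is_square ((coefB E)%:~R * d)
    | exists x, [/\ x != 0, is_square (x * d)
      & is_square (x ^+ 3 + (coefA E)%:~R * x ^+ 2 + (coefB E)%:~R * x)]].
Proof.
move=> d0 B0; split=> [[[|x y] /= PE]|].
- by move/(sqclass_eqP (oner_neq0 K) d0); rewrite mul1r; constructor 1.
- case: eqVneq => [_|x0]; first by move/(sqclass_eqP B0 d0); constructor 2.
  move/(sqclass_eqP x0 d0) => xd; constructor 3.
  by exists x; split=> //; exists y.
case=> [d_sq|Bd|[x [x0 xd [y yE]]]].
- by exists Origin => //=; apply/(sqclass_eqP (oner_neq0 K) d0); rewrite mul1r.
- exists (Affine 0 0); first by rewrite /points /= !expr0n /= !mulr0 !addr0.
  by rewrite /= eqxx; apply/(sqclass_eqP B0 d0).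
- exists (Affine x y); first exact/esym.
  by rewrite /= (negPf x0); apply/(sqclass_eqP x0 d0).
Qed.

Variable n : nat.
Local Notation N := (n%:Z%:~R : K).
Local Notation E := (curve_pi3 n).
Hypothesis N0 : N != 0.

Lemma is_square_common_factor x a b :
  x != 0 -> is_square (x * a) -> is_square (x * b) -> is_square (a * b).
Proof. by move=> x0 sa sb; apply: (is_square_mul_eq x0 sa sb); ring. Qed.

Lemma descent_image_pi3P d : 3 != 0 :> K -> d != 0 -> descent_image E K (sqclass d) <->
  [\/ is_square d, is_square (-3 * d)
    | exists t, [/\ t != 0, is_square (N * t * d) & is_square (N * t * ((t - 1) * (t + 3)))]].
Proof.
move=> three d0.
have BE : (coefB E)%:~R = -3 * N ^+ 2 :> K by rewrite rmorphM rmorphN rmorphXn.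
have AE : (coefA E)%:~R = 2 * N :> K by rewrite rmorphM.
have B0 : (coefB E)%:~R != 0 :> K by rewrite BE mulf_neq0 ?expf_neq0 ?oppr_eq0.
rewrite descent_imageP // AE BE; split=> -[|Bd|[x [x0 xd xE]]]; try by constructor 1.
- by constructor 2; apply: (is_square_cancel N0); rewrite mulrAC.
- have xNt : x = N * (x / N) by rewrite mulrC divfK.
  constructor 3; exists (x / N); rewrite -xNt mulf_neq0 ?invr_eq0 //; split=> //.
  apply: (is_square_cancel N0); rewrite (_ : _ * _ = x * (x - N) * (x + 3 * N)).
    by move: xE; congr is_square; ring.
  by field.
- by constructor 2; rewrite mulrAC; apply: is_squareM => //; exact: is_square_sqr.
- constructor 3; exists (N * x); rewrite mulf_neq0 //; split=> //.
  rewrite (_ : _ + _ = N * x * ((x - 1) * (x + 3)) * N ^+ 2); last by ring.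
  by apply: is_squareM => //; exact: is_square_sqr.
Qed.

Lemma descent_image_pi3_torsion d : 3 != 0 :> K -> d != 0 ->
  sqspan N d \/ sqspan N (-3 * d) -> descent_image E K (sqclass d).
Proof.
move=> three d0 dN; apply/descent_image_pi3P => //; have sq0 : is_square (0 : K).
  by exists 0; rewrite expr0n.
case: dN => -[dN|dN]; [by constructor 1|constructor 3|by constructor 2|constructor 3].
  by exists 1; rewrite oner_neq0 subrr mul0r mulr0 mulr1.
by exists (-3); rewrite oppr_eq0 addNr !mulr0 -mulrA.
Qed.

Lemma descent_image_isogenousP d : 2 != 0 :> K -> d != 0 ->
  descent_image (isogenous E) K (sqclass d) <->
  is_square d \/
  exists t, [/\ t != 0, is_square (N * t * d) & is_square (N * t * (t ^+ 2 - t + 1))].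
Proof.
move=> two d0; have four : 4 != 0 :> K by rewrite (_ : 4 = 2 * 2) ?mulf_neq0 //; ring.
have BE : (coefB (isogenous E))%:~R = (4 * N) ^+ 2 :> K.
  by rewrite /= !(rmorphD, rmorphM, rmorphN, rmorphXn) /=; ring.
have AE : (coefA (isogenous E))%:~R = - (4 * N) :> K.
  by rewrite /= !(rmorphM, rmorphN) /=; ring.
have N4 : 4 * N != 0 by rewrite mulf_neq0.
rewrite descent_imageP // ?AE BE ?expf_neq0 //.
split=> [[|Bd|[x [x0 xd xE]]]|[|[t [t0 td tE]]]]; try by [left|constructor 1].
- by left; apply: (is_square_cancel N4); rewrite mulrC.
- have xNt : N * (x / (4 * N)) = x / 4 by field; rewrite four.
  right; exists (x / (4 * N)); rewrite mulf_neq0 ?invr_eq0 //; split=> //.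
    rewrite xNt; apply: (is_square_cancel two).
    by rewrite (_ : _ * 2 ^+ 2 = x * d) //; field; rewrite four.
  apply: (is_square_cancel (mulf_neq0 two N4)).
  rewrite (_ : _ * (2 * (4 * N)) ^+ 2 = x ^+ 3 + - (4 * N) * x ^+ 2 + (4 * N) ^+ 2 * x) //.
  by field; rewrite four andbT.
- constructor 3; exists (4 * N * t); rewrite !mulf_neq0 //; split=> //.
    rewrite (_ : _ * _ = N * t * d * 2 ^+ 2); last by ring.
    by apply: is_squareM => //; exact: is_square_sqr.
  rewrite (_ : _ + _ = N * t * (t ^+ 2 - t + 1) * (8 * N) ^+ 2); last by ring.
  by apply: is_squareM => //; exact: is_square_sqr.
Qed.

(* The points of abscissa [4 N t] with [t = - w], for a primitive cube root of unity
   [w = (w^2)^2] when [-3] is a square, and [t = - 1] when [-3 N] is a square. *)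
Lemma descent_image_isogenous_torsion d : 2 != 0 :> K -> d != 0 ->
  sqspan N (-3) -> is_square (- N * d) -> descent_image (isogenous E) K (sqclass d).
Proof.
move=> two d0 N3 Nd; apply/descent_image_isogenousP => //; right.
case: N3 => [/(is_square_N3 two) [w wE]|N3]; last first.
  exists (-1); rewrite oppr_eq0 oner_neq0; split=> //; first by rewrite mulrN1.
  by rewrite (_ : _ * (_ + _) = N * -3) //; ring.
have w0 : w != 0 by apply: contra_eqN wE => /eqP ->; rewrite expr0n !add0r oner_eq0.
exists (- w); rewrite oppr_eq0; split=> //.
  rewrite (_ : _ * d = - N * d * (w ^+ 2) ^+ 2).
    by apply: is_squareM => //; exact: is_square_sqr.
  transitivity (- N * d * ((w ^+ 2) ^+ 2 - w * (w - 1) * (w ^+ 2 + w + 1))); first by ring.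
  by rewrite wE mulr0 subr0.
by rewrite sqrrN opprK wE mulr0; exists 0; rewrite expr0n.
Qed.

End DescentImage.

Section OddLocalImages.
Variables (p : nat) (p_pr : prime p) (n : nat).
Hypothesis p_odd : odd p.
Local Notation Zp := (padic_int p_pr).
Local Notation Qp := (padic p_pr).
Local Notation red := (red_Fp p_pr).
Local Notation N := (n%:Z%:~R : Qp).
Local Notation E := (curve_pi3 n).
Hypothesis N_unif : uniformizer N.
Implicit Types (a u : Zp) (d t : Qp).

Let N0 : N != 0 := uniformizer_neq0 N_unif.

Lemma is_square_congr t a u :
  red a = red u -> red u != 0 -> is_square (t * a%:Qp) -> is_square (t * u%:Qp).
Proof.
move=> au u0 sta; have u_unit : u \is a GRing.unit by rewrite padic_unitE.
have a_unit : a \is a GRing.unit by rewrite padic_unitE au.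
apply: (is_square_mul_eq (unit_Zp_to_Qp_neq0 a_unit) sta (b := (a * u)%:Qp)); last first.
  by rewrite rmorphM; ring.
by apply/is_square_unit; rewrite ?unitrM ?a_unit //; exists (red u); rewrite rmorphM au.
Qed.

Lemma red_square_uniformizer a : is_square (N * a%:Qp) -> red a = 0.
Proof.
move=> sa; apply/eqP; apply: contraPT sa; rewrite -padic_unitE => a_unit.
exact: uniformizer_nonsquare (uniformizerMunit N_unif a_unit).
Qed.

Lemma square_pi3_unit u : u \is a GRing.unit ->
  is_square (N * u%:Qp * ((u%:Qp - 1) * (u%:Qp + 3))) -> is_square u%:Qp \/ is_square (-3 * u%:Qp).
Proof.
move=> u_unit uE; have /red_square_uniformizer/eqP : is_square (N * (u * ((u - 1) * (u + 3)))%:Qp).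
  by rewrite !(rmorph_nat, rmorphM, rmorphB, rmorphD, rmorph1) mulrA.
rewrite padic_unitE in u_unit.
rewrite !(rmorph_nat, rmorphM, rmorphB, rmorphD, rmorph1) mulf_eq0 (negPf u_unit) orFb.
rewrite mulf_eq0 subr_eq0 addr_eq0 => /orP [] /eqP redE; [left|right].
  rewrite -[X in is_square X]mul1r; apply: (is_square_congr (a := 1)) => //.
    by rewrite rmorph1.
  by rewrite mul1r rmorph1; exact: is_square1.
apply: (is_square_congr (a := -3)) => //; first by rewrite rmorphN rmorph_nat.
by rewrite rmorphN rmorph_nat -expr2; exact: is_square_sqr.
Qed.

Lemma square_pi3_small a (t := p%:R * a%:Qp) :
  is_square (N * t * ((t - 1) * (t + 3))) -> is_square (N * t * -3) \/ is_square (-3 * t).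
Proof.
have [p3|p3] := eqVneq p 3%N; last first.
  rewrite /t -Zp_to_Qp_pM => tE; left.
  have -> : -3 = (-3 : Zp)%:Qp by rewrite rmorphN rmorph_nat.
  apply: (is_square_congr (a := (p%:R * a - 1) * (p%:R * a + 3))).
  - by rewrite !(rmorph_nat, rmorphM, rmorphB, rmorphD, rmorphN, rmorph1) pchar_Fp_0 //; ring.
  - by rewrite rmorphN oppr_eq0 red_nat_neq0 // eq_sym.
  - by rewrite !(rmorph_nat, rmorphM, rmorphB, rmorphD, rmorph1) in tE *.
have three0 : 3 != 0 :> Qp by exact: Qp_nat_neq0.
have three_Fp : 3 = 0 :> 'F_p by rewrite -(rmorph_nat red) -p3 red_Fp_p.
have tE : t = 3 * a%:Qp by congr (_%:R * _).
rewrite tE => sE; have {}sE : is_square (N * a%:Qp * ((a + 1) * (3 * a - 1))%:Qp).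
  apply: (is_square_cancel three0); move: sE; congr is_square.
  by rewrite !(rmorph_nat, rmorphM, rmorphB, rmorphD, rmorph1); ring.
have /red_square_uniformizer/eqP : is_square (N * (a * ((a + 1) * (3 * a - 1)))%:Qp).
  by rewrite rmorphM mulrA.
rewrite !(rmorph_nat, rmorphM, rmorphB, rmorphD, rmorph1) three_Fp.
rewrite mul0r sub0r mulrN1 mulf_eq0 oppr_eq0 addr_eq0.
have N1_neq0 : red (-1) != 0 by rewrite rmorphN1 oppr_eq0 oner_neq0.
case/orP=> /eqP aE; [left|right].
  have /(is_square_mul_eq (oner_neq0 _) (is_square_sqr 3)) : is_square (N * a%:Qp * (-1 : Zp)%:Qp).
    apply: is_square_congr sE => //.
    by rewrite !(rmorph_nat, rmorphM, rmorphB, rmorphD, rmorphN, rmorph1) three_Fp aE; ring.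
  by apply; rewrite rmorphN1; ring.
have : is_square (-1 * a%:Qp).
  apply: (is_square_congr (a := -1)); rewrite ?aE ?rmorphN1 // -?(rmorphN1 red) //.
  by rewrite mulrNN mulr1; exact: is_square1.
by move/(is_square_mul_eq (oner_neq0 _) (is_square_sqr 3)); apply; ring.
Qed.

Lemma square_pi3_large t a : t * (p%:R * a%:Qp) = 1 ->
  is_square (N * t * ((t - 1) * (t + 3))) -> is_square (N * t).
Proof.
move=> ta1 sE; have t0 : t != 0 by apply: contra_eqN ta1 => /eqP ->; rewrite mul0r eq_sym oner_eq0.
rewrite -[N * t]mulr1 -(rmorph1 (Zp_to_Qp p_pr)).
apply: (is_square_congr (a := (1 - p%:R * a) * (1 + 3 * (p%:R * a)))).
- by rewrite !(rmorph_nat, rmorphM, rmorphB, rmorphD, rmorph1) pchar_Fp_0 //; ring.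
- by rewrite rmorph1 oner_neq0.
apply: (is_square_cancel t0); move: sE; congr is_square.
rewrite !(rmorph_nat, rmorphM, rmorphB, rmorphD, rmorph1).
transitivity (N * t * ((t - t * (p%:R * a%:Qp)) * (t + 3 * (t * (p%:R * a%:Qp))))); last by ring.
by rewrite ta1 mulr1.
Qed.

Lemma descent_image_pi3_odd d : d != 0 ->
  descent_image E Qp (sqclass d) <-> sqspan N d \/ sqspan N (-3 * d).
Proof.
have three0 : 3 != 0 :> Qp by exact: Qp_nat_neq0.
move=> d0; split; last exact: descent_image_pi3_torsion.
case/(descent_image_pi3P N0 three0 d0) => [d_sq|d_sq|[t [t0 td sE]]].
- by left; left.
- by right; left.
have class_t e : is_square (e * t) -> sqspan N (e * d).
  rewrite mulrC => te; right; rewrite mulrCA; apply: (is_square_common_factor t0 te).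
  by rewrite mulrCA mulrA.
have class_Nt e : is_square (N * t * e) -> sqspan N (e * d).
  by move=> Nte; left; exact: (is_square_common_factor (mulf_neq0 N0 t0) Nte td).
rewrite -[in sqspan N d](mul1r d); case: (padicP t) => [u u_unit tE|a tE|a ta1].
- rewrite tE in sE class_t; have [su|su] := square_pi3_unit u_unit sE.
    by left; apply: class_t; rewrite mul1r.
  by right; exact: class_t.
- rewrite tE in sE class_t class_Nt.
  by have [su|su] := square_pi3_small sE; right; [exact: class_Nt|exact: class_t].
- by left; apply: class_Nt; rewrite mulr1; exact: square_pi3_large ta1 sE.
Qed.

Lemma square_isogenous_unit u : u \is a GRing.unit ->
  is_square (N * u%:Qp * (u%:Qp ^+ 2 - u%:Qp + 1)) -> is_square (-1 * u%:Qp) /\ sqspan N (-3).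
Proof.
move=> u_unit sE; have /red_square_uniformizer/eqP : is_square (N * (u * (u ^+ 2 - u + 1))%:Qp).
  by rewrite !(rmorphM, rmorphXn, rmorphB, rmorphD, rmorph1) mulrA.
have u0 := u_unit; rewrite padic_unitE in u0.
rewrite rmorphM mulf_eq0 (negPf u0) orFb => /eqP w0.
have Nu_sq : is_square (-1 * u%:Qp).
  apply: (is_square_congr (a := -1 * u ^+ 4)) => //.
    transitivity (red (u - u * (u + 1) * (u ^+ 2 - u + 1))); first by congr (red _); ring.
    by rewrite rmorphB [red (_ * (_ + _))]rmorphM w0 mulr0 subr0.
  exists (u%:Qp ^+ 2); rewrite rmorphM rmorphN1 rmorphXn; ring.
split=> //; have [p3|p3] := eqVneq p 3%N; [right|left].
  have pE : p%:R = 3 :> Qp by congr (_%:R).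
  have [a uaE] : exists a, u + 1 = p%:R * a.
    apply/red_Fp_eq0/eqP; rewrite -sqrf_eq0 -rmorphXn (_ : _ ^+ 2 = u ^+ 2 - u + 1 + 3 * u).
      by rewrite rmorphD w0 add0r rmorphM -p3 red_Fp_p mul0r.
    by ring.
  have uE : u%:Qp = 3 * a%:Qp - 1.
    by rewrite -pE -Zp_to_Qp_pM -uaE rmorphD rmorph1 addrK.
  have Nu3_sq : is_square (N * u%:Qp * 3 * (1 : Zp)%:Qp).
    apply: (is_square_congr (a := p%:R * (a ^+ 2 - a) + 1)).
    - by rewrite rmorphD red_pM add0r.
    - by rewrite rmorph1 oner_neq0.
    move: sE; congr is_square; rewrite !(rmorphD, Zp_to_Qp_pM, rmorphB, rmorphXn, rmorph1) pE uE.
    by ring.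
  rewrite (_ : N * -3 = N * 3 * -1); last by ring.
  apply: (is_square_common_factor (unit_Zp_to_Qp_neq0 u_unit)); last by rewrite mulrC.
  by move: Nu3_sq; rewrite rmorph1; congr is_square; ring.
have -> : -3 = 1 * (-3 : Zp)%:Qp by rewrite mul1r rmorphN rmorph_nat.
apply: (is_square_congr (a := (2 * u - 1) ^+ 2)).
- transitivity (red (4 * (u ^+ 2 - u + 1) + -3)); first by congr (red _); ring.
  by rewrite rmorphD rmorphM w0 mulr0 add0r.
- by rewrite rmorphN oppr_eq0 red_nat_neq0 // eq_sym.
- by rewrite mul1r rmorphXn; exact: is_square_sqr.
Qed.

Lemma square_isogenous_small a (t := p%:R * a%:Qp) :
  is_square (N * t * (t ^+ 2 - t + 1)) -> is_square (N * t).
Proof.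
rewrite /t -Zp_to_Qp_pM => sE; rewrite -[X in is_square X]mulr1 -(rmorph1 (Zp_to_Qp p_pr)).
apply: (is_square_congr (a := (p%:R * a) ^+ 2 - p%:R * a + 1)).
- by rewrite !(rmorphD, rmorphN, rmorphXn, red_pM, rmorph1); ring.
- by rewrite rmorph1 oner_neq0.
- by rewrite !(rmorphD, rmorphN, rmorphXn, rmorph1).
Qed.

Lemma descent_image_isogenous_odd d : d != 0 ->
  descent_image (isogenous E) Qp (sqclass d) <->
  is_square d \/ sqspan N (-3) /\ is_square (- N * d).
Proof.
have two0 : 2 != 0 :> Qp by exact: Qp_nat_neq0.
move=> d0; rewrite descent_image_isogenousP //; split; last first.
  case=> [|[N3 Nd]]; first by left.
  exact/(descent_image_isogenousP N0 two0 d0)/descent_image_isogenous_torsion.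
case=> [|[t [t0 td sE]]]; first by left.
have of_Nt : is_square (N * t) -> is_square d.
  by move=> Nt; apply: (is_square_mulr (mulf_neq0 N0 t0) Nt); rewrite mulrC.
case: (padicP t) => [u u_unit tE|a tE|a ta1].
- right; rewrite tE in sE; have [Nt N3] := square_isogenous_unit u_unit sE; split=> //.
  rewrite (_ : - N * d = -1 * (N * d)); last by ring.
  apply: (is_square_common_factor t0); first by rewrite mulrC tE.
  by rewrite mulrCA mulrA.
- by left; apply: of_Nt; rewrite tE in sE *; exact: square_isogenous_small.
- left; apply: of_Nt; set t' := p%:R * a%:Qp in ta1.
  have t'0 : t' != 0 by apply: contra_eqN ta1 => /eqP ->; rewrite mulr0 eq_sym oner_eq0.
  apply: (is_square_cancel t'0); rewrite (_ : _ * _ = N * t' * (t * t')); last by ring.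
  rewrite ta1 mulr1; apply: square_isogenous_small; rewrite -/t'.
  apply: (is_square_cancel (expf_neq0 2 t0)); move: sE; congr is_square.
  transitivity (N * (t * t') * t * ((t * t') ^+ 2 - (t * t') * t + t ^+ 2)); last by ring.
  by rewrite ta1; ring.
Qed.

End OddLocalImages.

Lemma is_square_N3_Fp (p : nat) : prime p -> odd p -> p != 3%N ->
  is_square (-3 : 'F_p) <-> (p %% 3 = 1)%N.
Proof.
move=> p_pr p_odd p3; have p_gt1 := prime_gt1 p_pr.
have p3F : ~~ (3 %| p)%N by rewrite dvdn_prime2 // eq_sym.
have Fp_neq0 (i : nat) : (0 < i < p)%N -> i%:R != 0 :> 'F_p.
  by case/andP=> i_gt0 i_ltp; rewrite (natr_Fp_eq0 p_pr) expn1 gtnNdvd.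
have two0 : 2 != 0 :> 'F_p by apply: Fp_neq0; lia.
have three0 : 3 != 0 :> 'F_p.
  by rewrite (natr_Fp_eq0 p_pr) expn1 dvdn_prime2.
rewrite is_square_N3 // cube_root_unityP // card_Fp //; lia.
Qed.

Section DyadicLocalImages.
Variables (p_pr : prime 2) (n : nat).
Local Notation Z2 := (padic_int p_pr).
Local Notation Q2 := (padic p_pr).
Local Notation red := (red_Z8 p_pr).
Local Notation N := (n%:Z%:~R : Q2).
Local Notation E := (curve_pi3 n).
Hypothesis n_mod8 : (n %% 8)%N \in [:: 1; 3; 7]%N.
Implicit Types (d : int) (a u : Z2).

Let n_Z2 : Z2 := n%:Z%:~R.

Lemma unit_n_Z2 : n_Z2 \is a GRing.unit.
Proof. by rewrite unit_intr; move: n_mod8; rewrite !inE; lia. Qed.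

Lemma n_Z2E : n_Z2%:Qp = N.
Proof. by rewrite rmorph_int. Qed.

Lemma n_Q2_neq0 : N != 0.
Proof. by rewrite -n_Z2E unit_Zp_to_Qp_neq0 ?unit_n_Z2. Qed.

Lemma unit_1D2 a : 1 + 2 * a \is a GRing.unit.
Proof. by rewrite padic_unitE rmorphD rmorph1 red_pM addr0 oner_neq0. Qed.

Lemma not_two_dvd_of_unit_class d u : ~~ (2%:Z ^+ 2 %| d)%Z -> u \is a GRing.unit ->
  is_square (u%:Qp * d%:~R) -> ~~ (2 %| d)%Z.
Proof.
move=> d4 u_unit ud; apply/negP => d2; apply: uniformizer_nonsquare ud.
by rewrite mulrC; apply: uniformizerMunit => //; exact: uniformizer_intr.
Qed.

(* [N t] has the class of a unit, whatever the valuation of [t]. *)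
Lemma square_pi3_unit_class (t : Q2) :
  t != 0 -> is_square (N * t * ((t - 1) * (t + 3))) ->
  exists2 u, u \is a GRing.unit & is_square (N * t * u%:Qp).
Proof.
move=> t0 sE; case: (padicP t) => [u u_unit tE|a tE|a ta1].
- exists (n_Z2 * u); first by rewrite unitrM unit_n_Z2.
  by rewrite rmorphM n_Z2E tE -expr2; exact: is_square_sqr.
- exists ((1 + 2 * (a - 1)) * (1 + 2 * (a + 1))); first by rewrite unitrM !unit_1D2.
  move: sE; congr (is_square (_ * _)); rewrite tE.
  by rewrite !(rmorph_nat, rmorphM, rmorphB, rmorphD, rmorph1); ring.
- exists ((1 + 2 * - a) * (1 + 2 * (3 * a))); first by rewrite unitrM !unit_1D2.
  apply: (is_square_cancel t0); move: sE; congr is_square.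
  transitivity (N * t * ((t - t * (2 * a%:Qp)) * (t + 3 * (t * (2 * a%:Qp))))).
    by rewrite ta1 mulr1.
  by rewrite !(rmorph_nat, rmorphN, rmorphM, rmorphD, rmorph1); ring.
Qed.

Lemma Z8_torsion_cases (a b : 'Z_8) : a \is a GRing.unit -> b \in [:: 1; 3; 7] ->
  [|| a == 1, -3 * a == 1, b * a == 1, b * (-3 * a) == 1
    | (b == 1) && ((3 * a == 1) || (- a == 1))].
Proof.
rewrite !inE => a_unit /or3P [] /eqP ->; move: a_unit;
  by case: a => -[|[|[|[|[|[|[|[|//]]]]]]]].
Qed.

Lemma n_Z8_cases : (n%:Z%:~R : 'Z_8) \in [:: 1; 3; 7].
Proof.
have nE : (n%:Z%:~R : 'Z_8) = (n %% 8)%:R by rewrite Zp_nat_mod.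
by rewrite nE; move: n_mod8; rewrite !inE => /or3P [] /eqP ->.
Qed.

Lemma descent_image_pi3_two d : ~~ (2%:Z ^+ 2 %| d)%Z ->
  descent_image E Q2 (sqclass d%:~R) <-> ~~ (2 %| d)%Z.
Proof.
move=> d4; have d0 : d%:~R != 0 :> Q2.
  by rewrite Qp_intr_eq0; apply: contraNneq d4 => ->; rewrite dvdz0.
have three0 : 3 != 0 :> Q2 by exact: Qp_nat_neq0.
split=> [/(descent_image_pi3P n_Q2_neq0 three0 d0)|d2].
  case=> [d_sq|d_sq|[t [t0 td /(square_pi3_unit_class t0) [u u_unit tu]]]].
  - by apply: (not_two_dvd_of_unit_class d4 (unitr1 _)); rewrite rmorph1 mul1r.
  - apply: (not_two_dvd_of_unit_class (u := -3) d4); last by rewrite rmorphN rmorph_nat.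
    by rewrite -[-3]/((-3)%:~R) unit_intr.
  - apply: (not_two_dvd_of_unit_class d4 u_unit).
    exact: is_square_common_factor (mulf_neq0 n_Q2_neq0 t0) tu td.
have d_unit : d%:~R \is a @GRing.unit 'Z_8.
  by rewrite -(rmorph_int red) rmorph_unit // unit_intr.
have sq (e : int) (x : Q2) : e%:~R = x -> (e%:~R : 'Z_8) == 1 -> is_square x.
  by move=> <- /eqP; exact: is_square_intr_Z8.
have /or4P [d1|d1|nd|/orP [nd|/andP [n1 nd]]] := Z8_torsion_cases d_unit n_Z8_cases.
- by apply: (descent_image_pi3_torsion n_Q2_neq0 three0 d0); left; left; apply: sq d1.
- apply: (descent_image_pi3_torsion n_Q2_neq0 three0 d0); right; left.
  by apply: (sq (-3 * d)); rewrite rmorphM.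
- apply: (descent_image_pi3_torsion n_Q2_neq0 three0 d0); left; right.
  by apply: (sq (n%:Z * d)); rewrite rmorphM.
- apply: (descent_image_pi3_torsion n_Q2_neq0 three0 d0); right; right.
  by apply: (sq (n%:Z * (-3 * d))); rewrite !rmorphM.
have N_sq : is_square N by exact: sq n1.
apply/(descent_image_pi3P n_Q2_neq0 three0 d0); constructor 3.
case/orP: nd => nd; [exists 3|exists (-1)]; rewrite ?oppr_eq0 ?oner_neq0; split=> //.
- by rewrite -mulrA; apply: is_squareM => //; apply: (sq (3 * d)); rewrite rmorphM.
- rewrite (_ : _ * _ = N * 6 ^+ 2); last by ring.
  by apply: is_squareM => //; exact: is_square_sqr.
- by rewrite mulrN1 mulNr -mulrN; apply: is_squareM => //; apply: (sq (- d)); rewrite rmorphN.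
- rewrite (_ : _ * _ = N * 2 ^+ 2); last by ring.
  by apply: is_squareM => //; exact: is_square_sqr.
Qed.

Lemma unit_of_red_Z8_15 u : red u \in [:: 1; 5] -> u \is a GRing.unit.
Proof.
apply: contraTT; rewrite padic_unitE negbK => /eqP/red_Fp_eq0 [v ->].
by rewrite rmorphM rmorph_nat; case: (red v) => -[|[|[|[|[|[|[|[|//]]]]]]]].
Qed.

Lemma Z8_1D4_cases (a : 'Z_8) : 1 - 4 * a + 16 * a ^+ 2 \in [:: 1; 5].
Proof. by case: a => -[|[|[|[|[|[|[|[|//]]]]]]]]. Qed.

Lemma Z8_abscissa_cases (a b : 'Z_8) : b \in [:: 1; 3; 7] ->
  b * a * (a ^+ 2 - a + 1) = 1 -> b * a \in [:: 1; 5].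
Proof.
rewrite !inE => /or3P [] /eqP -> /eqP;
  by case: a => -[|[|[|[|[|[|[|[|//]]]]]]]].
Qed.

(* Both [t = 2 a] and [t = 1 / (2 a)] give this condition; [a] cannot be a unit. *)
Lemma square_isogenous_nonunit_class a (x := 2 * a%:Qp) :
  is_square (N * x * (x ^+ 2 - x + 1)) ->
  exists2 u, red u \in [:: 1; 5] & is_square (N * x * u%:Qp).
Proof.
set u := (2 * a) ^+ 2 - 2 * a + 1.
have uE : u%:Qp = x ^+ 2 - x + 1.
  by rewrite !(rmorph_nat, rmorphXn, rmorphM, rmorphD, rmorphN, rmorph1).
have u_unit : u \is a GRing.unit.
  rewrite padic_unitE !(rmorphD, rmorphN, rmorphXn, red_pM, rmorph1).
  by rewrite oppr0 expr0n !add0r oner_neq0.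
rewrite -uE => sE; exists u => //.
have [a_unit|] := boolP (a \is a GRing.unit).
  case: (uniformizer_nonsquare _ sE); exists (n_Z2 * a * u).
    by rewrite !unitrM unit_n_Z2 a_unit.
  by rewrite !rmorphM n_Z2E /x; ring.
rewrite padic_unitE negbK => /eqP/red_Fp_eq0 [b bE].
have -> : red u = 1 - 4 * red b + 16 * red b ^+ 2.
  by rewrite /u bE !(rmorph_nat, rmorphXn, rmorphM, rmorphD, rmorphN, rmorph1); ring.
exact: Z8_1D4_cases.
Qed.

Lemma square_isogenous_class (t : Q2) : t != 0 -> is_square (N * t * (t ^+ 2 - t + 1)) ->
  exists2 u, red u \in [:: 1; 5] & is_square (N * t * u%:Qp).
Proof.
move=> t0; case: (padicP t) => [u u_unit ->|a ->|a ta1] sE; first 1 last.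
- exact: square_isogenous_nonunit_class.
- set x := 2 * a%:Qp in ta1.
  have [|u u15 xu] := @square_isogenous_nonunit_class a.
    apply: (is_square_cancel (expf_neq0 2 t0)); move: sE; congr is_square; rewrite -/x.
    transitivity (N * (t * x) * t * ((t * x) ^+ 2 - (t * x) * t + t ^+ 2)); last by ring.
    by rewrite ta1; ring.
  exists u => //; rewrite (_ : N * t * _ = N * x * u%:Qp * t ^+ 2).
    by apply: is_squareM => //; exact: is_square_sqr.
  transitivity (N * (t * x) * t * u%:Qp); last by ring.
  by rewrite ta1 mulr1.
exists (n_Z2 * u); last by rewrite rmorphM n_Z2E -expr2; exact: is_square_sqr.
have ns : is_square (n_Z2 * u * (u ^+ 2 - u + 1))%:Qp.
  by rewrite !(rmorphXn, rmorphM, rmorphD, rmorphN, rmorph1) n_Z2E.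
rewrite rmorphM rmorph_int; apply: Z8_abscissa_cases n_Z8_cases _.
have := is_square_red_Z8_eq1 _ ns.
rewrite !(rmorphXn, rmorphM, rmorphD, rmorphN, rmorph1) rmorph_int.
apply; rewrite !unitrM unit_n_Z2 u_unit padic_unitE !(rmorphXn, rmorphD, rmorphN, rmorph1).
by case: (red_Fp p_pr u) => -[|[|//]].
Qed.

(* The class of 5 is the image of a point of abscissa 5. *)
Lemma descent_image_isogenous_Z8_5 d : (d%:~R : 'Z_8) = 5 ->
  descent_image (isogenous E) Q2 (sqclass d%:~R).
Proof.
move=> d5; have two0 : 2 != 0 :> Q2 by exact: Qp_nat_neq0.
have five0 : 5 != 0 :> Q2 by exact: Qp_nat_neq0.
have sq5 (e : int) : e%:~R = 5 :> 'Z_8 -> is_square (5 * e%:~R : Q2).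
  move=> e5; rewrite -[5 * _](intrM _ 5 e); apply: is_square_intr_Z8.
  by rewrite intrM [e%:~R]e5; exact: val_inj.
have N4_neq0 : 4 * N != 0.
  by apply: mulf_neq0 n_Q2_neq0; exact: Qp_nat_neq0.
have [t tE] : exists t, 4 * N * t = 5 by exists (5 / (4 * N)); rewrite mulrC divfK.
have d0 : d%:~R != 0 :> Q2.
  by rewrite Qp_intr_eq0; apply: contra_eqN d5 => /eqP ->; rewrite -val_eqE.
apply/(descent_image_isogenousP n_Q2_neq0 two0 d0); right; exists t; split.
- by apply: contraNneq five0 => t0; rewrite -tE t0 mulr0.
- apply: (is_square_cancel two0); rewrite (_ : _ * _ = 4 * N * t * d%:~R); last by ring.
  by rewrite tE; exact: sq5.
apply: (is_square_cancel (mulf_neq0 two0 N4_neq0)).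
rewrite (_ : _ * _ = 4 * N * t * ((4 * N * t) ^+ 2 - 4 * N * (4 * N * t) + (4 * N) ^+ 2)).
  rewrite tE (_ : _ - _ + _ = (25 - 20 * n%:Z + 16 * n%:Z ^+ 2)%:~R).
    apply: sq5; rewrite rmorphD rmorphB !rmorphM.
    suff Z8E (b : 'Z_8) : b \in [:: 1; 3; 7] -> 25 - 20 * b + 16 * (b * b) = 5.
      exact: Z8E n_Z8_cases.
    by rewrite !inE => /or3P [] /eqP ->; exact: val_inj.
  by rewrite rmorphD rmorphB !rmorphM; ring.
by ring.
Qed.

Lemma descent_image_isogenous_two d : ~~ (2%:Z ^+ 2 %| d)%Z ->
  descent_image (isogenous E) Q2 (sqclass d%:~R) <-> (d%:~R : 'Z_8) \in [:: 1; 5].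
Proof.
move=> d4; have d0 : d%:~R != 0 :> Q2.
  by rewrite Qp_intr_eq0; apply: contraNneq d4 => ->; rewrite dvdz0.
have two0 : 2 != 0 :> Q2 by exact: Qp_nat_neq0.
have isogenousP := descent_image_isogenousP n_Q2_neq0 two0 d0.
split=> [/isogenousP dE|].
  have [u u15 ud] : exists2 u, red u \in [:: 1; 5] & is_square (u%:Qp * d%:~R).
    case: dE => [d_sq|[t [t0 td /(square_isogenous_class t0) [u u15 tu]]]].
      by exists 1; rewrite rmorph1 ?mul1r.
    by exists u => //; exact: is_square_common_factor (mulf_neq0 n_Q2_neq0 t0) tu td.
  have u_unit := unit_of_red_Z8_15 u15.
  have d_unit : (d%:~R : Z2) \is a GRing.unit.
    by rewrite unit_intr; exact: not_two_dvd_of_unit_class d4 u_unit ud.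
  have : red (u * d%:~R) = 1.
    by apply: is_square_red_Z8_eq1; rewrite ?unitrM ?u_unit // rmorphM rmorph_int.
  rewrite rmorphM rmorph_int; move: u15; rewrite !inE => /orP [] /eqP -> /eqP;
    by case: (d%:~R : 'Z_8) => -[|[|[|[|[|[|[|[|//]]]]]]]].
rewrite !inE => /orP [/eqP d1|/eqP d5]; last exact: descent_image_isogenous_Z8_5.
by apply/isogenousP; left; exact: is_square_intr_Z8.
Qed.

End DyadicLocalImages.

Lemma intr_Z8_15 (d : int) : (d%:~R : 'Z_8) \in [:: 1; 5] <-> (4 %| d - 1)%Z.
Proof.
have [r [q [r_lt8 dE]]] : exists r : nat, exists q : int, (r < 8)%N /\ d = q * 8 + r%:Z.
  by exists `|(d %% 8)%Z|%N, (d %/ 8)%Z; lia.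
have -> : d%:~R = r%:R :> 'Z_8.
  by rewrite dE intrD intrM (_ : 8%:~R = 0 :> 'Z_8) ?mulr0 ?add0r //; exact: val_inj.
have -> : (4 %| d - 1)%Z = (r == 1)%N || (r == 5)%N.
  by rewrite dE; move: r r_lt8 {dE} => -[|[|[|[|[|[|[|[|//]]]]]]]] _ /=; lia.
by move: r r_lt8 {dE} => -[|[|[|[|[|[|[|[|//]]]]]]]].
Qed.

Section RealLocalImages.
Variables (R : realType) (n : nat).
Hypothesis n_gt0 : (0 < n)%N.
Local Notation N := (n%:Z%:~R : R).
Local Notation E := (curve_pi3 n).
Implicit Type d : R.

Let N_gt0 : 0 < N.
Proof. by rewrite ltr0z ltz_nat. Qed.

Lemma is_square_ge0 d : is_square d <-> 0 <= d.
Proof.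
split=> [[x ->]|d_ge0]; first exact: sqr_ge0.
by exists (Num.sqrt d); rewrite sqr_sqrtr.
Qed.

Lemma descent_image_pi3_real d : d != 0 -> descent_image E R (sqclass d).
Proof.
move=> d0; apply: (descent_image_pi3_torsion (lt0r_neq0 N_gt0) _ d0); first by rewrite pnatr_eq0.
have [d_ge0|d_lt0] := leP 0 d; [left; left|right; left]; apply/is_square_ge0 => //.
by rewrite mulNr oppr_ge0 mulr_ge0_le0 // ltW.
Qed.

Lemma descent_image_isogenous_real d : d != 0 ->
  descent_image (isogenous E) R (sqclass d) <-> 0 < d.
Proof.
have two0 : 2 != 0 :> R by rewrite pnatr_eq0.
move=> d0; rewrite (descent_image_isogenousP (lt0r_neq0 N_gt0) two0 d0).
rewrite lt_def d0 /= -is_square_ge0; split=> [[//|[t [t0 td tE]]]|d_sq]; last by left.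
have f_gt0 : 0 < t ^+ 2 - t + 1.
  have -> : t ^+ 2 - t + 1 = (t - 2^-1) ^+ 2 + 3 / 4 by field.
  by rewrite ltr_wpDl ?sqr_ge0 // divr_gt0 ?ltr0n.
move/is_square_ge0: tE; rewrite pmulr_lge0 // => Nt_ge0.
have Nt_gt0 : 0 < N * t by rewrite lt_def Nt_ge0 mulf_neq0 ?(lt0r_neq0 N_gt0).
by move/is_square_ge0: td; rewrite pmulr_rge0 // => /is_square_ge0.
Qed.

End RealLocalImages.

Lemma sqspan_N3_neq3 (p : nat) (p_pr : prime p) (c : int) :
  odd p -> uniformizer (c%:~R : padic p_pr) -> p != 3%N ->
  sqspan (c%:~R : padic p_pr) (-3) <-> (p %% 3 = 1)%N.
Proof.
move=> p_odd c_unif p3; have pN3 : ~~ (p %| (-3 : int))%Z.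
  by rewrite rpredN dvdzE /= dvdn_prime2.
have u_unit : ((-3)%:~R : padic_int p_pr) \is a GRing.unit by rewrite unit_intr.
rewrite -is_square_N3_Fp //.
have := sqspan_unit p_odd c_unif u_unit; rewrite !rmorph_int.
by rewrite -[(-3)%:~R]/(-3) -[in X in _ <-> X]/(-3).
Qed.

Lemma is_square_F3 (c : int) : ~~ (3 %| c)%Z -> is_square (c%:~R : 'F_3) <-> (3 %| c - 1)%Z.
Proof.
move=> c3; have c_neq0 : c%:~R != 0 :> 'F_3 by rewrite intr_Fp_eq0.
have -> : (3 %| c - 1)%Z = (c%:~R == 1 :> 'F_3).
  by rewrite -intr_Fp_eq0 // rmorphB rmorph1 subr_eq0.
split=> [[a aE]|/eqP ->]; last exact: is_square1.
by move: c_neq0; rewrite aE sqrf_eq0; case: a {aE} => -[|[|[|//]]].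
Qed.

Lemma sqspan_N3_at3 (p_pr : prime 3) (m : int) : ~~ (3 %| m)%Z ->
  sqspan ((m * 3)%:~R : padic p_pr) (-3) <-> (3 %| m - 2)%Z.
Proof.
move=> m3; have mE : m * 3 = -3 * - m by ring.
have m9 : ~~ (3%:Z ^+ 2 %| -3 * - m)%Z by rewrite -mE expr2 dvdz_mul2r.
have := sqspan_cofactor p_pr (isT : odd 3) _ m9; rewrite dvdz_mulr //= => /(_ isT).
rewrite -mE is_square_F3 ?rpredN // => ->; lia.
Qed.

(** * Selmer groups as sets of divisors *)

Definition sqfree (d : int) : Prop := forall r : nat, prime r -> ~~ (r%:Z ^+ 2 %| d)%Z.

Definition sqfree_in (M d : int) : Prop :=
  forall r : nat, prime r -> ~~ (r%:Z ^+ 2 %| d)%Z /\ ((r %| d)%Z -> (r %| M)%Z).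

(* For [p] dividing [3 m], the condition that [-3] lies in [<3 m>] inside [Q_p^* / Q_p^*2]. *)
Definition split_prime (m p : nat) : bool := (p %% 3 == 1)%N || (p == 3) && (m %% 3 == 2)%N.

Lemma sqfree_neq0 d : sqfree d -> d != 0.
Proof. by move=> /(_ 2%N isT); apply: contraNneq => ->; rewrite dvdz0. Qed.

Lemma sqfree_in_sqfree M d : sqfree_in M d -> sqfree d.
Proof. by move=> dM r /dM []. Qed.

Lemma odd_of_mod8 (n : nat) : (n %% 8)%N \in [:: 1; 3; 7]%N -> odd n.
Proof. by rewrite !inE; lia. Qed.

Section SelmerConditions.
Variables (R : realType) (n m : nat).
Local Notation N := n%:Z.
Local Notation E := (curve_pi3 n).
Hypotheses (n_sqfree : sqfree N) (nE : n = (3 * m)%N) (n_mod8 : (n %% 8)%N \in [:: 1; 3; 7]%N).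
Implicit Types (p : nat) (d : int).

Let NE : N = m%:Z * 3.
Proof. by rewrite nE mulnC PoszM. Qed.

Let n_odd : odd n := odd_of_mod8 n_mod8.

Lemma m_coprime3 : ~~ (3 %| m%:Z)%Z.
Proof.
apply/negP => /dvdzP [k kE]; have /negP := n_sqfree (isT : prime 3); apply.
by rewrite NE kE -mulrA dvdz_mull.
Qed.

Lemma odd_prime_divisor p : (p %| N)%Z -> odd p.
Proof. by rewrite dvdzE => pn; apply: dvdn_odd pn n_odd. Qed.

Lemma uniformizer_n p (p_pr : prime p) : (p %| N)%Z -> uniformizer (N%:~R : padic p_pr).
Proof. by move=> pN; apply: uniformizer_intr => //; exact: n_sqfree. Qed.

Lemma sqspan_N3 p (p_pr : prime p) : (p %| N)%Z ->
  sqspan (N%:~R : padic p_pr) (-3) <-> split_prime m p.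
Proof.
move=> pN; have [p3|p3] := eqVneq p 3%N; last first.
  rewrite (sqspan_N3_neq3 (odd_prime_divisor pN) (uniformizer_n p_pr pN)) //.
  by rewrite /split_prime (negPf p3) orbF; split=> [->//|/eqP].
subst p; rewrite NE sqspan_N3_at3 ?m_coprime3 // /split_prime /=.
by have := m_coprime3; lia.
Qed.

Lemma prime_dvd_badness (r : nat) : prime r ->
  (r %| badness E)%Z = (r == 2%N) || (r %| N)%Z.
Proof.
move=> r_pr; have -> : badness E = (2 ^ 4 * 3 ^ 2 * n ^ 6)%N%:Z.
  by rewrite /badness /= !PoszM -!rmorphXn /=; ring.
rewrite !dvdzE !absz_nat (Euclid_dvdM _ (n ^ 6)) // (Euclid_dvdM _ (3 ^ 2)) //.
rewrite !Euclid_dvdX // !andbT (@dvdn_prime2 r 2) // (@dvdn_prime2 r 3) //.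
have [->|_] := eqVneq r 3%N; last by rewrite orbF.
by rewrite nE dvdn_mulr // orbT.
Qed.

Lemma bad_placesP (Q : place -> Prop) : (forall v, bad_places E v -> Q v) <->
  Q Infinite /\ Q (@Finite 2 isT) /\ forall p (p_pr : prime p), (p %| N)%Z -> Q (Finite p_pr).
Proof.
split=> [bad|[Q_inf [Q_2 Q_odd]] [_|p p_pr] //=].
  split; first exact: bad.
  split; first by apply: bad; rewrite /= prime_dvd_badness.
  by move=> p p_pr pN; apply: bad; rewrite /= prime_dvd_badness // pN orbT.
rewrite prime_dvd_badness // => /predU1P [p2|]; last exact: Q_odd.
by subst p; rewrite (bool_irrelevance p_pr isT).
Qed.

Lemma sqfree_inP d : sqfree_in N d <-> bad_sqfree E d /\ ~~ (2 %| d)%Z.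
Proof.
split=> [dN|[dE d2] r r_pr].
  split=> [r r_pr|]; last by apply/negP => /(dN 2%N isT).2/odd_prime_divisor.
  by have [r2 rN] := dN r r_pr; split=> // /rN; rewrite prime_dvd_badness // => ->; rewrite orbT.
have [r2 rE] := dE r r_pr; split=> // rd; have := rE rd.
rewrite prime_dvd_badness // => /predU1P [r_2|//].
by case/negP: d2; move: rd; rewrite r_2.
Qed.

Lemma Selmer'P d : Selmer' R E d <->
  sqfree_in N d /\
  forall p (p_pr : prime p), (p %| N)%Z -> split_prime m p -> sqspan (N%:~R : padic p_pr) d%:~R.
Proof.
rewrite /Selmer' /= bad_placesP sqfree_inP /=.
have [dE|] := pselect (bad_sqfree E d); last by move=> ndE; split=> [[]|[[]]].
have d_neq0 : d != 0 := sqfree_neq0 (sqfree_in_sqfree dE).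
have image_odd p (p_pr : prime p) : (p %| N)%Z ->
    descent_image E (padic p_pr) (sqclass d%:~R) <->
    (split_prime m p -> sqspan (N%:~R : padic p_pr) d%:~R).
  move=> pN; have p_odd := odd_prime_divisor pN; have c_unif := uniformizer_n p_pr pN.
  have three0 : -3 != 0 :> padic p_pr by rewrite -[-3]/((-3)%:~R) Qp_intr_eq0.
  rewrite (descent_image_pi3_odd p_odd c_unif) ?sqspan_twist ?Qp_intr_eq0 //.
  by rewrite sqspan_N3.
rewrite (descent_image_pi3_two _ n_mod8 (dE 2%N isT).1).
split=> [[_ [_ [d2 loc]]]|[[_ d2] loc]]; split=> //.
  by move=> p p_pr pN; apply/image_odd => //; exact: loc.
split; first by apply: descent_image_pi3_real; rewrite ?intr_eq0 // odd_gt0.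
by split=> // p p_pr pN; apply/image_odd => //; exact: loc.
Qed.

Lemma SelmerP d : Selmer R E d <->
  [/\ 0 < d, (4 %| d - 1)%Z, sqfree_in N d
    & forall p (p_pr : prime p), (p %| N)%Z ->
        if split_prime m p then sqspan ((- N)%:~R : padic p_pr) d%:~R
        else is_square (d%:~R : padic p_pr)].
Proof.
rewrite /Selmer /= bad_placesP /=.
have [dE|] := pselect (bad_sqfree E d); last by move=> ndE; split=> [[]|[_ _ /sqfree_inP []]].
have d_neq0 : d != 0 := sqfree_neq0 (sqfree_in_sqfree dE).
have image_odd p (p_pr : prime p) : (p %| N)%Z ->
    descent_image (isogenous E) (padic p_pr) (sqclass d%:~R) <->
    (if split_prime m p then sqspan ((- N)%:~R : padic p_pr) d%:~R
     else is_square (d%:~R : padic p_pr)).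
  move=> pN; have p_odd := odd_prime_divisor pN; have c_unif := uniformizer_n p_pr pN.
  rewrite (descent_image_isogenous_odd p_odd c_unif) ?Qp_intr_eq0 // sqspan_N3 // /sqspan rmorphN.
  case: ifP => // _; first by split=> -[]; [left|case; right|left|right].
  by split=> [[//|[]]|]; last by left.
rewrite (descent_image_isogenous_two _ n_mod8 (dE 2%N isT).1) intr_Z8_15.
rewrite descent_image_isogenous_real ?intr_eq0 ?odd_gt0 // ltr0z.
split=> [[_ [d_gt0 [d4 loc]]]|[d_gt0 d4 _ loc]]; split=> //.
- by apply/sqfree_inP; split=> //; apply/negP; move: d4; lia.
- by move=> p p_pr pN; apply/image_odd => //; exact: loc.
- by split=> //; split=> // p p_pr pN; apply/image_odd => //; exact: loc.
Qed.

End SelmerConditions.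

(** * Residue graphs *)

Lemma legendre_existsE (a : int) (p : nat) : prime p ->
  [exists x : 'I_p, (x%:Z ^+ 2 == a %[mod p])%Z] = `[< is_square (a%:~R : 'F_p) >].
Proof.
move=> p_pr; have mod_square (x : int) :
    (x ^+ 2 == a %[mod p])%Z = (a%:~R == x%:~R ^+ 2 :> 'F_p).
  by rewrite eqz_mod_dvd -intr_Fp_eq0 // rmorphB rmorphXn subr_eq0 eq_sym.
apply/existsP/asboolP => [[x]|[y yE]]; first by rewrite mod_square => /eqP aE; exists x%:Z%:~R.
have y_lt : (y < p)%N by rewrite -[X in (_ < X)%N](Fp_cast p_pr) ltn_ord.
by exists (Ordinal y_lt); rewrite mod_square yE [_%:~R]natr_Zp.
Qed.

Lemma legendre_eqN1 (a : int) (p : nat) : prime p ->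
  (legendre a p == -1) = ~~ `[< is_square (a%:~R : 'F_p) >].
Proof.
move=> p_pr; rewrite /legendre legendre_existsE //; case: ifPn => [|_]; last by case: asboolP.
rewrite -intr_Fp_eq0 // => /eqP ->; rewrite asboolT //.
by exists 0; rewrite expr0n.
Qed.

Lemma legendre_eq1 (a : int) (p : nat) : prime p ->
  legendre a p = 1 <-> ~~ (p %| a)%Z /\ is_square (a%:~R : 'F_p).
Proof.
move=> p_pr; rewrite /legendre legendre_existsE //.
by case: (p %| a)%Z; [split=> // -[]|case: asboolP => sa; split=> // -[]].
Qed.

Definition fset_symdiff (T : choiceType) (A B : {fset T}) : {fset T} :=
  ((A `\` B) `|` (B `\` A))%fset.

Lemma in_fset_symdiff (T : choiceType) (A B : {fset T}) v :
  (v \in fset_symdiff A B) = (v \in A) (+) (v \in B).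
Proof. by rewrite !inE; case: (v \in A); case: (v \in B). Qed.

Lemma fset_symdiff_subset (T : choiceType) (A B X : {fset T}) :
  (A `<=` X)%fset -> (B `<=` X)%fset -> (fset_symdiff A B `<=` X)%fset.
Proof. by move=> AX BX; rewrite fsubUset !(fsubset_trans (fsubsetDl _ _)). Qed.

Lemma pigeonhole_symdiff (T : choiceType) (I : eqType) (X : {fset T}) (C : seq I)
    (good : I -> {fset T} -> Prop) : (size C < #|` X|)%N ->
  (forall c A B, c \in C -> (A `<=` X)%fset -> (B `<=` X)%fset ->
     (good c A <-> good c B) -> good c (fset_symdiff A B)) ->
  exists A, [/\ (A `<=` X)%fset, A != fset0 & forall c, c \in C -> good c A].
Proof.
move=> lt_CX good_symdiff.
pose profile (A : fpowerset X) := [tuple of [seq `[< good c (val A) >] | c <- in_tuple C]].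
have : ~~ injectiveb profile.
  apply/negP => /injectiveP /leq_card; rewrite -cardfE card_fpowerset card_tuple card_bool.
  by rewrite leq_exp2l // leqNgt lt_CX.
case/injectivePn => A [B AB eqAB].
have AX : (val A `<=` X)%fset by rewrite -fpowersetE; exact: valP.
have BX : (val B `<=` X)%fset by rewrite -fpowersetE; exact: valP.
exists (fset_symdiff (val A) (val B)); split.
- exact: fset_symdiff_subset.
- apply: contraNneq AB => /fsetP AB0; apply/eqP/val_inj/fsetP => v.
  by have := AB0 v; rewrite in_fset_symdiff inE; case: (v \in val A); case: (v \in val B).
move=> c cC; apply: good_symdiff => //; apply: asbool_eq_equiv.
have /eq_in_map : [seq `[< good c (val A) >] | c <- C] = [seq `[< good c (val B) >] | c <- C].
  exact: (congr1 val eqAB).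
exact.
Qed.

Section VertexProd.
Implicit Types A B : {fset int}.

Lemma vertex_prod0 : vertex_prod fset0 = 1.
Proof. exact: big_seq_fset0. Qed.

Lemma vertex_prod_seq (s : seq int) : uniq s ->
  vertex_prod [fset v in s]%fset = \prod_(v <- s) v.
Proof.
move=> s_uniq; apply: perm_big; apply: uniq_perm; [exact: fset_uniq|by []|].
by move=> v; rewrite !inE.
Qed.

Lemma vertex_prodU A B : [disjoint A & B]%fset ->
  vertex_prod (A `|` B)%fset = vertex_prod A * vertex_prod B.
Proof.
move=> /fdisjointP AB; rewrite /vertex_prod (big_fsetID _ (mem A)) /=.
congr (_ * _); apply: eq_fbigl => v; rewrite !inE /=.
  by case: (v \in A); rewrite ?andbF.
by case: (boolP (v \in A)) => [/AB/negPf ->|_] //=; rewrite ?andbT ?andbF.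
Qed.

Lemma vertex_prodID A B : vertex_prod A = vertex_prod (A `&` B)%fset * vertex_prod (A `\` B)%fset.
Proof.
rewrite -vertex_prodU ?fsetID //.
by apply/fdisjointP => v; rewrite !inE => /andP [_ ->].
Qed.

Lemma vertex_prod_symdiff A B :
  vertex_prod (fset_symdiff A B) * vertex_prod (A `&` B)%fset ^+ 2 =
  vertex_prod A * vertex_prod B.
Proof.
rewrite vertex_prodU; last by apply/fdisjointP => v; rewrite !inE => /andP [_ ->].
rewrite (vertex_prodID A B) (vertex_prodID B A) (fsetIC B A).
by move: (vertex_prod (A `&` B)%fset) (vertex_prod _) (vertex_prod _) => *; ring.
Qed.

Lemma vertex_prodD1 A v : v \in A -> vertex_prod A = v * vertex_prod (A `\ v)%fset.
Proof. exact: big_fsetD1. Qed.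

Lemma dvdz_vertex_prod A v : v \in A -> (v %| vertex_prod A)%Z.
Proof. by move=> /vertex_prodD1 ->; exact: dvdz_mulr. Qed.

Lemma vertex_prod_ind (P : int -> Prop) A : P 1 -> (forall a b, P a -> P b -> P (a * b)) ->
  (forall v, v \in A -> P v) -> P (vertex_prod A).
Proof. by move=> P1 PM PA; rewrite /vertex_prod big_seq; elim/big_ind: _. Qed.

Lemma prime_dvd_vertex_prod (p : nat) A : prime p ->
  (p %| vertex_prod A)%Z -> exists2 v, v \in A & (p %| v)%Z.
Proof.
move=> p_pr; apply: contraPP => no_v; apply/negP.
apply: (@vertex_prod_ind (fun a => ~~ (p %| a)%Z)) => [|a b|v vA].
- by rewrite dvdzE dvdn1; case: p p_pr {no_v} => [|[]].
- by rewrite !dvdzE abszM Euclid_dvdM // negb_or => -> ->.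
- by apply/negP => pv; apply: no_v; exists v.
Qed.

End VertexProd.

Section ResidueGraph.
Variable M : int.
Hypothesis M_sqfree : sqfree M.
Local Notation G := (residue_graph M).
Implicit Types A B : {fset int}.

Lemma vertexP v : reflect (M < 0 /\ v = -1 \/ exists r : nat, [/\ prime r, (r %| M)%Z & v = r%:Z])
  (v \in vertices G).
Proof.
rewrite /= !inE /=; apply: (iffP orP).
  case=> [|/mapP [r]].
    by case: ifP => // M0; rewrite inE => /eqP ->; left.
  by rewrite mem_primes => /and3P [r_pr _ rM] ->; right; exists r.
case=> [[-> ->]|[r [r_pr rM ->]]]; first by left; rewrite inE.
by right; apply: map_f; rewrite mem_primes r_pr absz_gt0 sqfree_neq0.
Qed.

Lemma prime_vertexE (r : nat) : prime r -> (r%:Z \in vertices G) = (r %| M)%Z.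
Proof.
move=> r_pr; apply/vertexP/idP => [[[_]|[r' [_ r'M [->]]]]|rM] //.
by right; exists r.
Qed.

Lemma N1_vertexE : (-1 \in vertices G) = (M < 0).
Proof. by apply/vertexP/idP => [[[]|[r []]]|M0] //; left. Qed.

Lemma vertices_subset (d : int) : sqfree_in M d -> (d < 0 -> M < 0) ->
  (vertices (residue_graph d) `<=` vertices G)%fset.
Proof.
move=> dM dM_lt0; apply/fsubsetP => v; rewrite /= !inE /= => /orP [].
  by case: ifP => // /dM_lt0 M_lt0; rewrite inE => /eqP ->; move: N1_vertexE; rewrite M_lt0 /= !inE.
move=> /mapP [r]; rewrite mem_primes => /and3P [r_pr _ rd] ->.
by have := prime_vertexE r_pr; rewrite /= !inE => ->; exact: (dM r r_pr).2.
Qed.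

Lemma prod_primes (k : nat) : sqfree k%:Z -> (\prod_(r <- primes k) r)%N = k.
Proof.
move=> k_sq; have k_gt0 : (0 < k)%N by have := sqfree_neq0 k_sq; rewrite lt0n.
rewrite [RHS](prod_prime_decomp k_gt0) /primes big_map.
apply: eq_big_seq => -[r e] /mem_prime_decomp [r_pr e_gt0 rk] /=.
case: e e_gt0 rk => [//|[|e]] _ rk; first by rewrite expn1.
case/negP: (k_sq r r_pr); rewrite dvdzE abszX !absz_nat.
by apply: dvdn_trans rk; apply: dvdn_exp2l.
Qed.

Lemma vertex_prod_graph : vertex_prod (vertices G) = M.
Proof.
have M_absq : sqfree `|M|%N%:Z by move=> r /M_sqfree; rewrite !dvdzE absz_nat.
have primes_uniq : uniq [seq r%:Z | r <- primes `|M|%N].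
  by rewrite map_inj_uniq ?primes_uniq // => x y [].
have prodE : \prod_(r <- [seq r%:Z | r <- primes `|M|%N]) r = `|M|%N%:Z.
  by rewrite big_map -[in RHS](prod_primes M_absq) (big_morph Posz PoszM (erefl _)).
rewrite vertex_prod_seq; last first.
  rewrite cat_uniq primes_uniq andbT.
  by case: ifP => _ /=; rewrite -all_predC; apply/allP => x /mapP [r _ ->].
rewrite big_cat /= prodE; case: ltP => M0; last by rewrite big_nil mul1r gez0_abs.
by rewrite big_seq1 mulN1r ltz0_abs // opprK.
Qed.

Section VertexSubsets.
Variable A : {fset int}.
Hypothesis AV : (A `<=` vertices G)%fset.

Lemma vertex_prod_complement : vertex_prod A * vertex_prod (vertices G `\` A)%fset = M.
Proof. by rewrite -[RHS]vertex_prod_graph [RHS](vertex_prodID _ A) (fsetIidPr AV). Qed.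

Lemma prime_dvd_vertex_prodE (r : nat) : prime r -> (r %| vertex_prod A)%Z = (r%:Z \in A).
Proof.
move=> r_pr; apply/idP/idP => [|/dvdz_vertex_prod//].
move=> /(prime_dvd_vertex_prod r_pr) [v vA].
have [[_ ->]|[r' [r'_pr _ vE]]] := vertexP _ (fsubsetP AV _ vA).
  by rewrite rpredN dvdzE dvdn1; case: r r_pr => [|[]].
by subst v; rewrite dvdzE !absz_nat dvdn_prime2 // => /eqP ->.
Qed.

Lemma vertex_prod_lt0E : (vertex_prod A < 0) = (-1 \in A).
Proof.
have pos B : (B `<=` A)%fset -> -1 \notin B -> 0 < vertex_prod B.
  move=> BA N1B; apply: (@vertex_prod_ind (fun a => 0 < a)) => //.
    by move=> a b; exact: mulr_gt0.
  move=> v vB; have [[_ vE]|[r [r_pr _ ->]]] := vertexP _ (fsubsetP (fsubset_trans BA AV) _ vB).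
    by rewrite -vE vB in N1B.
  by rewrite ltz_nat prime_gt0.
have [N1A|N1A] := boolP (-1 \in A); last by apply/negbTE; rewrite -leNgt ltW ?pos.
rewrite (vertex_prodD1 N1A) mulN1r oppr_lt0 pos ?fsubD1set //.
by rewrite !inE eqxx.
Qed.

Lemma vertex_prod_sqfree_in : sqfree_in M (vertex_prod A).
Proof.
have AM : (vertex_prod A %| M)%Z by rewrite -vertex_prod_complement dvdz_mulr.
move=> r r_pr; split=> [|rA]; last exact: dvdz_trans rA AM.
by apply: contra (M_sqfree r_pr) => r2; exact: dvdz_trans r2 AM.
Qed.

Lemma vertex_prod_neq0 : vertex_prod A != 0.
Proof. exact/sqfree_neq0/sqfree_in_sqfree/vertex_prod_sqfree_in. Qed.

End VertexSubsets.

Lemma vertex_prod_eq1 A : (A `<=` vertices G)%fset -> vertex_prod A = 1 -> A = fset0.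
Proof.
move=> AV A1; apply/eqP; apply: contraT => /fset0Pn [v vA].
have [[_ vE]|[r [r_pr _ vE]]] := vertexP _ (fsubsetP AV _ vA); subst v.
  by rewrite -vertex_prod_lt0E // A1 in vA.
by rewrite -prime_dvd_vertex_prodE // A1 dvdzE dvdn1 in vA; case: r r_pr vA => [|[]].
Qed.

Section Arcs.
Implicit Types (p : nat) (v : int) (W : {fset int}).

Lemma arcs_intoE v W : arcs_into G v W = count (arc G v) W.
Proof.
rewrite /arcs_into -size_filter; apply: perm_size; apply: uniq_perm.
- exact: fset_uniq.
- by rewrite filter_uniq // fset_uniq.
- by move=> x; rewrite mem_filter !inE andbC.
Qed.

Lemma odd_arcs_into p W : prime p -> (p %% 3 = 1)%N -> (forall w, w \in W -> ~~ (p %| w)%Z) ->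
  odd (arcs_into G p W) = ~~ `[< is_square ((vertex_prod W)%:~R : 'F_p) >].
Proof.
move=> p_pr p1 pW; rewrite arcs_intoE /vertex_prod.
have {pW} : {in enum_fset W, forall w, w%:~R != 0 :> 'F_p}.
  by move=> w wW; rewrite intr_Fp_eq0 //; exact: pW.
elim: (enum_fset W) => [|w s IHs] ws_neq0.
  by rewrite big_nil asboolT //; exact: is_square1.
have w_neq0 : w%:~R != 0 :> 'F_p by apply: ws_neq0; rewrite mem_head.
have s_neq0 : {in s, forall w, w%:~R != 0 :> 'F_p}.
  by move=> v vs; apply: ws_neq0; rewrite inE vs orbT.
have prod_neq0 : (\prod_(v <- s) v)%:~R != 0 :> 'F_p.
  by rewrite rmorph_prod prodf_seq_neq0; apply/allP => v /s_neq0.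
have arcE : arc G p w = ~~ `[< is_square (w%:~R : 'F_p) >].
  rewrite /= legendre_eqN1 // ltz_nat prime_gt0 // modz_nat p1.
  by case: eqVneq => // pw; rewrite intr_Fp_eq0 // -pw dvdzz in w_neq0.
rewrite big_cons rmorphM is_square_mulE // -[count _ _]/(arc G p w + count (arc G p) s)%N.
by rewrite oddD arcE IHs // oddb; case: asboolP; case: asboolP.
Qed.

Lemma arcs_into_eq0 v W : v \in vertices G -> (forall p, prime p -> v = p -> (p %% 3 != 1)%N) ->
  arcs_into G v W = 0%N.
Proof.
move=> vG not1; rewrite arcs_intoE; apply/eqP; rewrite -leqn0 leqNgt -has_count -all_predC.
apply/allP => w _ /=; apply/negP => /and4P [_ v_gt0 v1 _].
have [[_ vE]|[p [p_pr _ vE]]] := vertexP _ vG; first by rewrite vE in v_gt0.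
by have /negP := not1 p p_pr vE; apply; rewrite -eqz_nat -modz_nat -vE.
Qed.

End Arcs.

Definition spanned (d : int) : Prop := forall p (p_pr : prime p),
  (p %| M)%Z -> (p %% 3 = 1)%N -> sqspan (M%:~R : padic p_pr) d%:~R.

Lemma spanned_complement A : (A `<=` vertices G)%fset ->
  spanned (vertex_prod A) -> spanned (vertex_prod (vertices G `\` A)%fset).
Proof.
move=> AV AS p p_pr pM p1; apply: (@sqspan_cancel _ _ (vertex_prod A)%:~R).
  by rewrite Qp_intr_eq0 vertex_prod_neq0.
rewrite expr2 mulrA -rmorphM [_ * vertex_prod A]mulrC vertex_prod_complement //.
by apply: sqspanM (sqspan_id _) (AS p p_pr pM p1); rewrite Qp_intr_eq0 sqfree_neq0.
Qed.

Lemma nontrivial_partitionP A B : nontrivial_partition G A B <->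
  [/\ (A `<=` vertices G)%fset, A != fset0, A != vertices G & B = (vertices G `\` A)%fset].
Proof.
split=> [[A0 B0 /fdisjointP AB ABV]|[AV A0 AV' ->]].
  have BE : B = (vertices G `\` A)%fset.
    apply/fsetP => v; rewrite -ABV !inE; have := AB v.
    by case: (v \in A) => [/(_ isT)/negPf ->|].
  split; rewrite // -?ABV ?fsubsetUl //.
  by apply: contraNneq B0 => AE; rewrite BE -ABV -AE fsetDv.
split=> //.
- by rewrite fsetD_eq0; apply: contraNN AV' => VA; rewrite eqEfsubset AV.
- by apply/fdisjointP => v vA; rewrite inE vA.
- by rewrite -[RHS](fsetID A) (fsetIidPr AV).
Qed.

Section OddPartition.
Hypothesis M_odd : forall p : nat, prime p -> (p %| M)%Z -> odd p.
Variable A : {fset int}.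
Hypothesis AV : (A `<=` vertices G)%fset.
Local Notation B := (vertices G `\` A)%fset.

Lemma sqspan_arcs p (p_pr : prime p) : (p %| M)%Z -> (p %% 3 = 1)%N ->
  sqspan (M%:~R : padic p_pr) (vertex_prod A)%:~R <->
  ~~ odd (arcs_into G p (if p%:Z \in A then B else A)).
Proof.
move=> pM p1; have ABE := vertex_prod_complement AV.
rewrite -[X in sqspan X%:~R _]ABE sqspan_cofactor ?ABE ?M_sqfree ?(M_odd p_pr pM) //.
have BV : (B `<=` vertices G)%fset by exact: fsubsetDl.
have coprime_to C : (C `<=` vertices G)%fset -> p%:Z \notin C ->
    forall w, w \in C -> ~~ (p %| w)%Z.
  move=> CV pC w wC; apply: contra pC => pw; rewrite -prime_dvd_vertex_prodE //.
  exact: dvdz_trans pw (dvdz_vertex_prod wC).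
rewrite prime_dvd_vertex_prodE //; case: ifPn => pA.
  by rewrite odd_arcs_into ?negbK; [split=> /asboolP| | |apply: coprime_to; rewrite ?inE ?pA].
by rewrite odd_arcs_into ?negbK; [split=> /asboolP| | |apply: coprime_to].
Qed.

Lemma odd_partitionP : odd_partition G A B <-> ~ spanned (vertex_prod A).
Proof.
have partP v : v \in vertices G ->
    odd (arcs_into G v (if v \in A then B else A)) -> odd_partition G A B.
  by case: ifPn => vA vG odd_v; [left|right]; exists v; rewrite // inE vA.
have not_spanned v : v \in vertices G -> odd (arcs_into G v (if v \in A then B else A)) ->
    ~ spanned (vertex_prod A).
  move=> vG odd_v AS; have no_arc : arcs_into G v (if v \in A then B else A) = 0%N -> False.
    by move=> v0; rewrite v0 in odd_v.
  apply/no_arc/arcs_into_eq0 => // p p_pr vE; apply/eqP => p1; subst v.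
  rewrite prime_vertexE // in vG.
  by have := (sqspan_arcs p_pr vG p1).1 (AS p p_pr vG p1); rewrite odd_v.
split=> [[] [v vAB odd_v]|nAS].
- by apply: (not_spanned v); rewrite ?vAB // (fsubsetP AV).
- by move: vAB; rewrite inE => /andP [vA vG]; apply: (not_spanned v); rewrite // (negPf vA).
apply: contrapT => not_odd; apply: nAS => p p_pr pM p1.
apply/(sqspan_arcs p_pr pM p1)/negP => odd_p; apply: not_odd.
by apply: partP odd_p; rewrite prime_vertexE.
Qed.

Lemma nontrivial_odd_partitionP :
  (nontrivial_partition G A B -> odd_partition G A B) <->
  (spanned (vertex_prod A) -> A = fset0 \/ A = vertices G).
Proof.
split=> [odd_AB AS|trivial_A /nontrivial_partitionP [_ /eqP A0 /eqP AV' _]].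
  have [A0|A0] := eqVneq A fset0; [by left|right]; apply/eqP; apply: contraT => AV'.
  by have /odd_partitionP := odd_AB ((nontrivial_partitionP A B).2 (And4 AV A0 AV' erefl)).
by apply/odd_partitionP => /trivial_A [].
Qed.

End OddPartition.

Lemma odd_graphP : (forall p : nat, prime p -> (p %| M)%Z -> odd p) ->
  odd_graph G <->
  forall A, (A `<=` vertices G)%fset -> spanned (vertex_prod A) -> A = fset0 \/ A = vertices G.
Proof.
move=> M_odd; split=> [oddG A AV|trivialG A B].
  by apply/nontrivial_odd_partitionP => //; exact: oddG.
move=> AB; have [AV _ _ BE] := (nontrivial_partitionP A B).1 AB; subst B.
by apply: (nontrivial_odd_partitionP M_odd AV).2 AB; exact: trivialG.
Qed.

End ResidueGraph.

(** * Symmetric differences and square classes *)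

Lemma sqspan_symdiff (p : nat) (p_pr : prime p) (c : padic p_pr) (A B : {fset int}) :
  odd p -> uniformizer c -> vertex_prod A != 0 -> vertex_prod B != 0 ->
  (sqspan c (vertex_prod A)%:~R <-> sqspan c (vertex_prod B)%:~R) ->
  sqspan c (vertex_prod (fset_symdiff A B))%:~R.
Proof.
move=> p_odd c_unif A0 B0 AB.
have I0 : (vertex_prod (A `&` B)%fset)%:~R != 0 :> padic p_pr.
  by rewrite Qp_intr_eq0; apply: contraNneq A0 => I0; rewrite (vertex_prodID A B) I0 mul0r.
apply: (sqspan_cancel I0); rewrite -rmorphXn -rmorphM vertex_prod_symdiff rmorphM.
have [cA|ncA] := pselect (sqspan c (vertex_prod A)%:~R).
  by apply: sqspanM; [exact: uniformizer_neq0|exact: cA|exact/AB].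
by apply: sqspan_index2; rewrite ?Qp_intr_eq0 // -AB.
Qed.

Lemma prime_dvd_prod (s : seq nat) (r : nat) : (forall x, x \in s -> prime x) -> prime r ->
  (r %| \prod_(x <- s) x)%N = (r \in s).
Proof.
move=> s_pr r_pr; elim: s s_pr => [|x s IHs] s_pr.
  by rewrite big_nil dvdn1 in_nil; apply: gtn_eqF; exact: prime_gt1.
have x_pr : prime x by apply: s_pr; rewrite mem_head.
rewrite big_cons Euclid_dvdM // dvdn_prime2 // inE IHs // => y ys.
by apply: s_pr; rewrite inE ys orbT.
Qed.

Lemma sqfree_prod (s : seq nat) : (forall x, x \in s -> prime x) -> uniq s ->
  sqfree (\prod_(x <- s) x)%N%:Z.
Proof.
elim: s => [|x s IHs] s_pr /= => [_|/andP [xs s_uniq]] r r_pr; rewrite dvdzE abszX !absz_nat.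
  by rewrite big_nil dvdn1 -[1%N](exp1n 2) eqn_exp2r // gtn_eqF // prime_gt1.
have x_pr : prime x by apply: s_pr; rewrite mem_head.
have s_pr' y : y \in s -> prime y by move=> ys; apply: s_pr; rewrite inE ys orbT.
rewrite big_cons; have [->|rx] := eqVneq r x.
  by rewrite -mulnn dvdn_pmul2l ?prime_gt0 // prime_dvd_prod.
rewrite Gauss_dvdr; last by rewrite coprimeXl // prime_coprime // dvdn_prime2.
by have := IHs s_pr' s_uniq r r_pr; rewrite dvdzE abszX !absz_nat.
Qed.

Lemma is_square_Q3 (p_pr : prime 3) (d : int) : (3 %| d - 1)%Z -> is_square (d%:~R : padic p_pr).
Proof.
by move=> d1; apply/is_square_intr; rewrite ?is_square_F3 //; move: d1; lia.
Qed.

Lemma vertex_prod_mod3 (A : {fset int}) : (forall v, v \in A -> (3 %| v - 1)%Z) ->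
  (3 %| vertex_prod A - 1)%Z.
Proof.
apply: vertex_prod_ind => [|a b a1 b1]; first by rewrite subrr.
have -> : a * b - 1 = a * (b - 1) + (a - 1) by ring.
by rewrite rpredD ?dvdz_mull.
Qed.

Lemma not_sqspan_Q3 (p_pr : prime 3) (c : padic p_pr) (d : int) :
  uniformizer c -> (3 %| d - 1)%Z -> ~ sqspan c (- d)%:~R.
Proof.
move=> c_unif d1; have Nd3 : ~~ (3 %| - d)%Z by lia.
have Nd_unit : (- d)%:~R \is a @GRing.unit (padic_int p_pr) by rewrite unit_intr.
have := sqspan_unit (isT : odd 3) c_unif Nd_unit.
by rewrite !rmorph_int is_square_F3 // => ->; lia.
Qed.

Lemma mod4_factor (a b : int) : (4 %| a * b - 3)%Z -> (4 %| a - 1)%Z || (4 %| b - 1)%Z.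
Proof.
move=> ab; apply: contraTT ab; rewrite negb_or => /andP [a1 b1].
have [[c aE]|[c aE]] : (exists c, a = 2 * c) \/ exists c, a = 4 * c - 1.
- case: (boolP (2 %| a)%Z) => [/dvdzP [c ->]|a2]; [by left; exists c; rewrite mulrC|right].
  by exists ((a + 1) %/ 4)%Z; move: a1 a2; lia.
- by rewrite aE -mulrA; move: (c * b); lia.
have -> : a * b - 3 = 4 * (c * b) - b - 3 by rewrite aE; ring.
by move: (c * b) b1; lia.
Qed.

Lemma is_square_legendre (p : nat) (p_pr : prime p) (d : int) : odd p -> sqfree d ->
  is_square (d%:~R : padic p_pr) <-> legendre d p = 1.
Proof.
move=> p_odd d_sqfree; rewrite legendre_eq1 //; have [pd|pd] := boolP (p %| d)%Z.
  split=> [/uniformizer_nonsquare|[]//]; case.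
  by apply: uniformizer_intr => //; exact: d_sqfree.
by rewrite is_square_intr //; split=> [|[]].
Qed.

(** * The Selmer groups of the theorem *)

Section SelmerGroups.
Variables (R : realType) (ps qs : seq nat) (n m : nat).
Hypothesis ps_prime : forall x, x \in ps -> [/\ prime x, odd x & (x %% 3 = 1)%N].
Hypothesis qs_prime : forall x, x \in qs -> [/\ prime x, odd x & (x %% 3 = 2)%N].
Hypothesis pq_uniq : uniq (ps ++ qs).
Hypothesis mE : m = (\prod_(x <- ps ++ qs) x)%N.
Hypothesis nE : n = (3 * m)%N.
Hypothesis n_mod24 : (n %% 24)%N \in [:: 3; 9; 15]%N.
Local Notation N := n%:Z.
Local Notation E := (curve_pi3 n).
Local Notation V := (vertices (residue_graph N)).
Local Notation W := (vertices (residue_graph (- N))).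
Implicit Types A D : {fset int}.

Let pq_prime x : x \in ps ++ qs -> prime x.
Proof. by rewrite mem_cat => /orP [/ps_prime []|/qs_prime []]. Qed.

Let three_notin : 3%N \notin ps ++ qs.
Proof. by rewrite mem_cat; apply/negP => /orP [/ps_prime []|/qs_prime []]. Qed.

Let three_vertex : 3%:Z \notin [seq x%:Z | x <- ps ++ qs].
Proof. by apply: contra three_notin => /mapP [x x_in [->]]. Qed.

Let n_prime x : x \in 3%N :: ps ++ qs -> prime x.
Proof. by rewrite inE => /predU1P [->//|/pq_prime]. Qed.

Let n_prod : n = (\prod_(x <- 3 :: ps ++ qs) x)%N.
Proof. by rewrite big_cons -mE. Qed.

Lemma sqfree_n : sqfree N.
Proof. by rewrite n_prod; apply: sqfree_prod; [exact: n_prime|rewrite /= three_notin]. Qed.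

Lemma sqfree_m : sqfree m%:Z.
Proof. by rewrite mE; apply: sqfree_prod; first exact: pq_prime. Qed.

Lemma sqfree_Nn : sqfree (- N).
Proof. by move=> r r_pr; rewrite rpredN sqfree_n. Qed.

Lemma prime_dvd_n r : prime r -> (r %| N)%Z = (r \in 3%N :: ps ++ qs).
Proof. by move=> r_pr; rewrite n_prod -(prime_dvd_prod n_prime r_pr). Qed.

Lemma prime_dvd_m r : prime r -> (r %| m%:Z)%Z = (r \in ps ++ qs).
Proof. by move=> r_pr; rewrite mE -(prime_dvd_prod pq_prime r_pr). Qed.

Let n_mod8 : (n %% 8)%N \in [:: 1; 3; 7]%N.
Proof. by move: n_mod24; rewrite !inE; lia. Qed.

Let n_gt0 : (0 < n)%N.
Proof. by have := sqfree_neq0 sqfree_n; rewrite lt0n. Qed.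

Let NE : N = m%:Z * 3.
Proof. by rewrite nE mulnC PoszM. Qed.

Let n_odd (p : nat) : (p %| N)%Z -> odd p.
Proof. exact: (odd_prime_divisor n_mod8). Qed.

Let m_mod3 : (m %% 3 = 1)%N \/ (m %% 3 = 2)%N.
Proof. by have := m_coprime3 sqfree_n nE; lia. Qed.

Let Selmer'E := Selmer'P R sqfree_n nE n_mod8.
Let SelmerE := SelmerP R sqfree_n nE n_mod8.

Lemma split_prime_divisor p : prime p -> (p %| N)%Z ->
  split_prime m p = (p \in ps) || (p == 3) && (m %% 3 == 2)%N.
Proof.
move=> p_pr; rewrite prime_dvd_n // inE mem_cat /split_prime => /or3P [/eqP ->|p_ps|p_qs].
- by move: three_notin; rewrite mem_cat negb_or => /andP [/negPf -> _].
- by have [_ _ ->] := ps_prime p_ps; rewrite p_ps.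
have [_ _ p2] := qs_prime p_qs; have /negPf -> : p \notin ps; last by rewrite p2.
by apply/negP => /ps_prime [_ _]; rewrite p2.
Qed.

Definition split_primes : seq nat := if (m %% 3 == 2)%N then 3%N :: ps else ps.

Lemma mem_split_primes p : prime p -> (p %| N)%Z -> split_prime m p = (p \in split_primes).
Proof.
move=> p_pr pN; rewrite split_prime_divisor // /split_primes.
by case: ifP => _; rewrite ?inE ?andbT ?andbF ?orbF // orbC.
Qed.

Lemma split_primes_sub : {subset split_primes <= 3%N :: ps ++ qs}.
Proof.
move=> x; rewrite /split_primes [in X in _ -> X]inE mem_cat.
by case: ifP => _; [rewrite inE => /predU1P [->|->]|move=> ->]; rewrite ?eqxx ?orbT.
Qed.

Lemma Selmer'_vertex_prodP A : (A `<=` W)%fset -> Selmer' R E (vertex_prod A) <->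
  forall p (p_pr : prime p), (p %| N)%Z -> split_prime m p ->
    sqspan (N%:~R : padic p_pr) (vertex_prod A)%:~R.
Proof.
move=> AW; rewrite Selmer'E; split=> [[]//|loc]; split=> // r r_pr.
by have := vertex_prod_sqfree_in sqfree_Nn AW r_pr; rewrite [(r %| - N)%Z]rpredN.
Qed.

Lemma Selmer'_as_vertex_prod d : Selmer' R E d ->
  (vertices (residue_graph d) `<=` W)%fset /\ vertex_prod (vertices (residue_graph d)) = d.
Proof.
move=> /Selmer'E [dN _]; split; last exact/vertex_prod_graph/sqfree_in_sqfree/dN.
apply: vertices_subset => [|r r_pr|_]; first exact: sqfree_Nn.
  by rewrite [(r %| - N)%Z]rpredN; exact: dN.
by rewrite oppr_lt0 ltz_nat.
Qed.

Lemma Selmer'_symdiff A B : (A `<=` W)%fset -> (B `<=` W)%fset ->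
  Selmer' R E (vertex_prod A) -> Selmer' R E (vertex_prod B) ->
  Selmer' R E (vertex_prod (fset_symdiff A B)).
Proof.
move=> AW BW /(Selmer'_vertex_prodP AW) SA /(Selmer'_vertex_prodP BW) SB.
apply/Selmer'_vertex_prodP => [|p p_pr pN sp].
  exact: fset_symdiff_subset.
apply: sqspan_symdiff (n_odd pN) (uniformizer_n sqfree_n p_pr pN) _ _ _.
- exact: vertex_prod_neq0 sqfree_Nn _ AW.
- exact: vertex_prod_neq0 sqfree_Nn _ BW.
by split=> _; [exact: SB|exact: SA].
Qed.

Let V_sub_W : (V `<=` W)%fset.
Proof.
apply: vertices_subset => [|r r_pr|]; first exact: sqfree_Nn.
  by rewrite [(r %| - N)%Z]rpredN; split=> //; exact: sqfree_n.
by rewrite ltNge.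
Qed.

Lemma in_vertices_Nn v :
  (v \in W) = (v == -1) || (v \in [seq x%:Z | x <- 3%N :: ps ++ qs]).
Proof.
apply/(vertexP sqfree_Nn)/orP => [[[_ ->]|[r [r_pr rN ->]]]|[/eqP ->|/mapP [r r_in ->]]].
- by left.
- by right; apply: map_f; rewrite -prime_dvd_n // -[(r %| N)%Z]rpredN.
- by left; rewrite oppr_lt0 ltz_nat.
- have r_pr := n_prime r_in; right; exists r; split=> //.
  by rewrite [(r %| - N)%Z]rpredN prime_dvd_n.
Qed.

Lemma in_vertices_n v : (v \in V) = (v \in [seq x%:Z | x <- 3%N :: ps ++ qs]).
Proof.
apply/(vertexP sqfree_n)/mapP => [[[]//|[r [r_pr rN ->]]]|[r r_in ->]].
  by exists r; rewrite -?prime_dvd_n.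
by have r_pr := n_prime r_in; right; exists r; rewrite prime_dvd_n.
Qed.

Local Notation T := [set 1; N; - m%:Z; - 3].

Definition trivial_vertices (b c : bool) : {fset int} :=
  fset_symdiff (if b then V else fset0) (if c then [fset -1; 3%:Z]%fset else fset0).

Let prod_V : vertex_prod V = N.
Proof. exact/vertex_prod_graph/sqfree_n. Qed.

Let prod_N1_3 : vertex_prod [fset -1; 3%:Z]%fset = -3.
Proof. by rewrite vertex_prodU ?fdisjoint1X ?inE // /vertex_prod !big_seq_fset1. Qed.

Lemma Selmer'_trivial b c :
  (trivial_vertices b c `<=` W)%fset /\ Selmer' R E (vertex_prod (trivial_vertices b c)).
Proof.
have N1_3_W : ([fset -1; 3%:Z] `<=` W)%fset.
  apply/fsubsetP => v; rewrite in_fset2 in_vertices_Nn => /orP [->//|/eqP ->].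
  by rewrite mem_head orbT.
have VW : ((if b then V else fset0) `<=` W)%fset by case: b => //; exact: fsub0set.
have CW : ((if c then [fset -1; 3%:Z] else fset0) `<=` W)%fset by case: c => //; exact: fsub0set.
split; first exact: fset_symdiff_subset.
apply: Selmer'_symdiff => //; apply/Selmer'_vertex_prodP => // p p_pr pN sp.
  case: b {VW}; last by rewrite vertex_prod0; exact: sqspan1.
  by rewrite prod_V; exact: sqspan_id.
case: c {CW}; last by rewrite vertex_prod0; exact: sqspan1.
by rewrite prod_N1_3; exact/(sqspan_N3 sqfree_n nE n_mod8).
Qed.

Lemma trivial_vertices_prod b c : vertex_prod (trivial_vertices b c) =
  if b then if c then - m%:Z else N else if c then -3 else 1.
Proof.
have symdiff0 (A : {fset int}) : fset_symdiff A fset0 = A.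
  by rewrite /fset_symdiff fsetD0 fset0D fsetU0.
have symdiff0l (A : {fset int}) : fset_symdiff fset0 A = A.
  by rewrite /fset_symdiff fsetD0 fset0D fset0U.
rewrite /trivial_vertices; case: b; case: c; rewrite ?symdiff0 ?symdiff0l //.
  2: exact: vertex_prod0.
have := vertex_prod_symdiff V [fset -1; 3%:Z]%fset.
have -> : (V `&` [fset -1; 3%:Z])%fset = [fset 3%:Z]%fset.
  apply/fsetP => v; rewrite in_fsetI in_fset2 in_fset1 in_vertices_n.
  have [->|] := eqVneq v 3; first by rewrite orbT mem_head.
  have [->|_] := eqVneq v (-1); last by rewrite andbF.
  by rewrite andbT => _; apply/mapP => -[].
rewrite prod_V prod_N1_3 [vertex_prod [fset 3%:Z]%fset]big_seq_fset1 NE.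
by move: (vertex_prod _); lia.
Qed.

Lemma vertex_prod_ps_mod3 A : {subset A <= [seq x%:Z | x <- ps]} -> (3 %| vertex_prod A - 1)%Z.
Proof.
move=> A_ps; apply: vertex_prod_mod3 => v /A_ps /mapP [x /ps_prime [_ _ x1] ->].
by move: x1; lia.
Qed.

Lemma subset_ps_V A : {subset A <= [seq x%:Z | x <- ps]} -> (A `<=` V)%fset.
Proof.
move=> A_ps; apply/fsubsetP => v /A_ps /mapP [x x_ps ->].
by rewrite in_vertices_n map_f // inE mem_cat x_ps orbT.
Qed.

Lemma Selmer'_of_ps A : {subset A <= [seq x%:Z | x <- ps]} ->
  Selmer' R E (vertex_prod A) <-> spanned N (vertex_prod A).
Proof.
move=> A_ps; rewrite Selmer'_vertex_prodP; last exact: fsubset_trans (subset_ps_V A_ps) V_sub_W.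
split=> [loc p p_pr pN p1|loc p p_pr pN].
  by apply: loc => //; rewrite /split_prime p1.
rewrite /split_prime => /orP [/eqP|/andP [/eqP p3 _]]; first exact: loc.
by subst p; left; apply: is_square_Q3; exact: vertex_prod_ps_mod3.
Qed.

Lemma subset_ps A : (A `<=` W)%fset -> -1 \notin A -> 3%:Z \notin A ->
  {in qs, forall q : nat, q%:Z \notin A} -> {subset A <= [seq x%:Z | x <- ps]}.
Proof.
move=> /fsubsetP AW A_N1 A_3 A_qs v vA; have := AW v vA; rewrite in_vertices_Nn.
case/predU1P => [vE|/mapP [x]]; first by rewrite -vE vA in A_N1.
rewrite inE mem_cat => /or3P [/eqP ->|x_ps|x_qs] vE.
- by rewrite -vE vA in A_3.
- by rewrite vE map_f.
- by have := A_qs x x_qs; rewrite -vE vA.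
Qed.

(* Otherwise the product is [- 1] modulo 3, which is not in [<n>] at 3. *)
Lemma Selmer'_N1_notin A : (m %% 3 = 2)%N -> (A `<=` W)%fset -> 3%:Z \notin A ->
  {in qs, forall q : nat, q%:Z \notin A} -> Selmer' R E (vertex_prod A) -> -1 \notin A.
Proof.
move=> m2 AW A_3 A_qs /(Selmer'_vertex_prodP AW) SA; apply/negP => N1A.
have A'_ps : {subset A `\ (-1) <= [seq x%:Z | x <- ps]}%fset.
  apply: subset_ps; rewrite ?in_fsetD1 ?eqxx //; first exact: fsubset_trans (fsubD1set _ _) AW.
  by move=> q /A_qs; rewrite in_fsetD1 => /negPf ->; rewrite andbF.
have d1 := vertex_prod_ps_mod3 A'_ps; have N3 : (3 %| N)%Z by rewrite prime_dvd_n ?mem_head.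
have p_pr : prime 3 by [].
have := SA 3%N p_pr N3; rewrite split_prime_divisor // m2 orbT => /(_ isT).
rewrite (vertex_prodD1 N1A) mulN1r.
exact: not_sqspan_Q3 (uniformizer_n sqfree_n p_pr N3) d1.
Qed.

Lemma in_trivial_vertices b c v : (v \in trivial_vertices b c) =
  (b && (v \in V)) (+) (c && ((v == -1) || (v == 3))).
Proof.
rewrite in_fset_symdiff; congr (_ (+) _); first by case: b; rewrite // in_fset0.
by case: c; rewrite ?in_fset2 ?in_fset0.
Qed.

(* Multiplying by a suitable trivial class removes the vertices [3] and [-1], or
   [3] and [q]; in the second case the condition at 3 removes [-1]. *)
Lemma Selmer'_reduction A : size qs = (m %% 3 == 2)%N ->
  (A `<=` W)%fset -> Selmer' R E (vertex_prod A) ->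
  exists b c, {subset fset_symdiff A (trivial_vertices b c) <= [seq x%:Z | x <- ps]}.
Proof.
move=> size_qs AW SA.
have three_V : 3%:Z \in V by rewrite in_vertices_n mem_head.
have N1_V : -1 \notin V by rewrite in_vertices_n; apply/mapP => -[].
have D_W b c : (fset_symdiff A (trivial_vertices b c) `<=` W)%fset.
  exact: fset_symdiff_subset AW (Selmer'_trivial b c).1.
have D_S b c : Selmer' R E (vertex_prod (fset_symdiff A (trivial_vertices b c))).
  by have [TW ST] := Selmer'_trivial b c; exact: Selmer'_symdiff.
have in_D b c v : (v \in fset_symdiff A (trivial_vertices b c)) =
    (v \in A) (+) ((b && (v \in V)) (+) (c && ((v == -1) || (v == 3)))).
  by rewrite in_fset_symdiff in_trivial_vertices.
have D_3 b c : c = (3%:Z \in A) (+) b -> 3%:Z \notin fset_symdiff A (trivial_vertices b c).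
  by move=> ->; rewrite in_D three_V !andbT; case: (_ \in A); case: b.
case: m_mod3 => m_eq; rewrite m_eq in size_qs.
  exists ((3%:Z \in A) (+) (-1 \in A)), (-1 \in A); apply: subset_ps => //.
  - by rewrite in_D (negPf N1_V) andbF andbT addbb.
  - by apply: D_3; rewrite addbA addbb.
  - by rewrite (size0nil size_qs).
have [q qsE] : exists q, qs = [:: q] by case: (qs) size_qs => [|q []] // _; exists q.
have q_V : q%:Z \in V by rewrite in_vertices_n map_f // inE mem_cat qsE mem_head !orbT.
have q_3 : (q%:Z == 3%:Z) = false.
  by rewrite eqz_nat; apply: contraNF three_notin => /eqP <-; rewrite mem_cat qsE mem_head orbT.
exists (q%:Z \in A), ((3%:Z \in A) (+) (q%:Z \in A)).
set D := fset_symdiff _ _; have D3 : 3%:Z \notin D by exact: D_3.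
have D_qs : {in qs, forall x : nat, x%:Z \notin D}.
  by move=> x; rewrite qsE inE => /eqP ->; rewrite in_D q_V q_3 andbT andbF addbF addbb.
have D_N1 : -1 \notin D := Selmer'_N1_notin m_eq (D_W _ _) D3 D_qs (D_S _ _).
exact: subset_ps (D_W _ _) D_N1 D3 D_qs.
Qed.

Lemma vertex_prod_gt0 A : (A `<=` V)%fset -> 0 < vertex_prod A.
Proof.
move=> AV; rewrite lt_def (vertex_prod_neq0 sqfree_n AV) leNgt (vertex_prod_lt0E sqfree_n AV).
by apply/negP => /(fsubsetP AV); rewrite in_vertices_n => /mapP [].
Qed.

Lemma trivial_class_eq0 A : (A `<=` V)%fset -> 3%:Z \notin A -> T (vertex_prod A) -> A = fset0.
Proof.
move=> AV A_3 TA; have A_gt0 := vertex_prod_gt0 AV.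
have not3 : ~~ (3 %| vertex_prod A)%Z by rewrite (prime_dvd_vertex_prodE sqfree_n AV).
case: TA => [[[A1|AN]|Am]|A3].
- exact: (vertex_prod_eq1 sqfree_n AV).
- by rewrite AN NE dvdz_mull in not3.
- by rewrite Am oppr_gt0 in A_gt0.
- by rewrite A3 in not3.
Qed.

Lemma Selmer'_sub_trivialP : size qs = (m %% 3 == 2)%N ->
  Selmer' R E `<=` T <->
  forall A, {subset A <= [seq x%:Z | x <- ps]} -> spanned N (vertex_prod A) -> A = fset0.
Proof.
move=> size_qs; split=> [S'T A A_ps AS|ps_trivial d].
  apply: trivial_class_eq0; first exact: subset_ps_V.
    by apply: contra three_vertex => /A_ps; rewrite map_cat mem_cat => ->.
  by apply: S'T; exact/(Selmer'_of_ps A_ps).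
move=> Sd; have [AW AE] := Selmer'_as_vertex_prod Sd; set A := vertices _ in AW AE.
rewrite -AE in Sd; have [b [c D_ps]] := Selmer'_reduction size_qs AW Sd.
have [TW ST] := Selmer'_trivial b c; have SD := Selmer'_symdiff AW TW Sd ST.
have /fsetP D0 := ps_trivial _ D_ps ((Selmer'_of_ps D_ps).1 SD).
have -> : d = vertex_prod (trivial_vertices b c).
  rewrite -AE; congr vertex_prod; apply/fsetP => v.
  by have := D0 v; rewrite in_fset_symdiff in_fset0; case: (v \in A); case: (v \in _).
rewrite trivial_vertices_prod.
by case: b {D_ps TW ST SD D0}; case: c; [left; right|left; left; right|right|left; left; left].
Qed.

Lemma Selmer'_eq_trivial : Selmer' R E = T <-> Selmer' R E `<=` T.
Proof.
split=> [->//|S'T]; apply/seteqP; split=> // d.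
have of_trivial b c : Selmer' R E (vertex_prod (trivial_vertices b c)) := (Selmer'_trivial b c).2.
case=> [[[->|->]|->]|->].
- by have := of_trivial false false; rewrite trivial_vertices_prod.
- by have := of_trivial true false; rewrite trivial_vertices_prod.
- by have := of_trivial true true; rewrite trivial_vertices_prod.
- by have := of_trivial false true; rewrite trivial_vertices_prod.
Qed.

Lemma prod_mod3 (s : seq nat) : (forall x, x \in s -> (x %% 3 = 1)%N) ->
  (\prod_(x <- s) x %% 3 = 1)%N.
Proof.
elim: s => [|x s IHs] H; first by rewrite big_nil.
rewrite big_cons -modnMm (H x (mem_head _ _)) IHs // => y ys.
by apply: H; rewrite inE ys orbT.
Qed.

Lemma in_vertices_m v : (v \in vertices (residue_graph m%:Z)) = (v \in [seq x%:Z | x <- ps ++ qs]).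
Proof.
apply/(vertexP sqfree_m)/mapP => [[[]//|[r [r_pr rm ->]]]|[r r_in ->]].
  by exists r; rewrite -?prime_dvd_m.
by have r_pr := pq_prime r_in; right; exists r; rewrite prime_dvd_m.
Qed.

(* The [2^(t+s)] divisors of [m] meet one condition of index two at each of the [t]
   primes of [ps], and one at 3 if [m = 2 mod 3]. *)
Lemma Selmer'_bound : Selmer' R E `<=` T -> (size qs <= (m %% 3 == 2))%N.
Proof.
move=> S'T; rewrite leqNgt; apply/negP => lt_qs.
set X := vertices (residue_graph m%:Z); have X_V : (X `<=` V)%fset.
  apply/fsubsetP => v; rewrite in_vertices_m in_vertices_n => /mapP [x x_in ->].
  by rewrite map_f // inE x_in orbT.
have X_W := fsubset_trans X_V V_sub_W.
have card_X : #|` X| = (size ps + size qs)%N.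
  rewrite -size_cat -(size_map Posz); apply/perm_size/uniq_perm.
  - exact: fset_uniq.
  2: exact: in_vertices_m.
  by rewrite map_inj_uniq // => x y [].
pose good p A := forall p_pr : prime p, sqspan (N%:~R : padic p_pr) (vertex_prod A)%:~R.
have [||A [AX A0 Agood]] := @pigeonhole_symdiff _ _ X split_primes good.
- by rewrite card_X /split_primes; move: lt_qs; clear; case: ifP => _ /=; lia.
- move=> p A B pC AX BX AB p_pr; have pN : (p %| N)%Z.
    by rewrite prime_dvd_n ?split_primes_sub.
  apply: sqspan_symdiff (n_odd pN) (uniformizer_n sqfree_n p_pr pN) _ _ _.
  - exact: vertex_prod_neq0 sqfree_m _ AX.
  - exact: vertex_prod_neq0 sqfree_m _ BX.
  have goodE D : good p D <-> sqspan (N%:~R : padic p_pr) (vertex_prod D)%:~R.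
    by split=> [|gD p_pr']; [exact|rewrite (bool_irrelevance p_pr' p_pr)].
  by rewrite -!goodE.
have AV := fsubset_trans AX X_V; case/eqP: A0; apply: (trivial_class_eq0 AV).
  by apply: contra three_vertex => /(fsubsetP AX); rewrite in_vertices_m.
apply: S'T; apply/Selmer'_vertex_prodP => [|p p_pr pN sp]; first exact: fsubset_trans AV V_sub_W.
by apply: Agood; rewrite -mem_split_primes.
Qed.

Lemma Selmer'_size_qs : Selmer' R E `<=` T -> size qs = (m %% 3 == 2)%N.
Proof.
move=> /Selmer'_bound qs_le; apply/eqP; rewrite eqn_leq qs_le /=.
case: eqP => //= m2; rewrite lt0n; apply/eqP => /size0nil qs0.
by move: m2; rewrite mE qs0 cats0 prod_mod3 // => x /ps_prime [].
Qed.

Let prime_n_odd p : prime p -> (p %| N)%Z -> odd p.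
Proof. by move=> _; exact: n_odd. Qed.

Let V_not_ps A : {subset A <= [seq x%:Z | x <- ps]} -> A <> V.
Proof.
move=> A_ps AV; have := three_vertex; rewrite map_cat mem_cat A_ps //.
by rewrite AV in_vertices_n mem_head.
Qed.

Lemma Selmer'_eq_trivial_odd_graph : (m %% 3 = 1)%N ->
  Selmer' R E = T <-> size qs = 0%N /\ odd_graph (residue_graph N).
Proof.
move=> m1; rewrite Selmer'_eq_trivial (odd_graphP sqfree_n prime_n_odd); split=> [S'T|[qs0 oddG]].
  split=> [|A AV AS]; first by rewrite (Selmer'_size_qs S'T) m1.
  have /S'T : Selmer' R E (vertex_prod A).
    apply/Selmer'_vertex_prodP; first exact: fsubset_trans AV V_sub_W.
    by move=> p p_pr pN; rewrite /split_prime m1 andbF orbF => /eqP; exact: AS.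
  have A_gt0 := vertex_prod_gt0 AV.
  case=> [[[A1|AN]|Am]|A3].
  - by left; exact: (vertex_prod_eq1 sqfree_n AV).
  - right; apply/eqP; rewrite eqEfsubset AV -fsetD_eq0; apply/eqP.
    apply: (vertex_prod_eq1 sqfree_n (fsubsetDl _ _)).
    apply: (mulfI (sqfree_neq0 sqfree_n)).
    by rewrite mulr1 -[RHS](vertex_prod_complement sqfree_n AV) AN.
  - by rewrite Am oppr_gt0 in A_gt0.
  - by rewrite A3 in A_gt0.
apply/Selmer'_sub_trivialP => [|A A_ps AS]; first by rewrite qs0 m1.
by have [] := oddG A (subset_ps_V A_ps) AS; last by move/(V_not_ps A_ps).
Qed.

Lemma Selmer'_eq_trivial_odd_partitions : (m %% 3 = 2)%N ->
  Selmer' R E = T <-> size qs = 1%N /\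
    forall A, {subset A <= [seq x%:Z | x <- ps]} ->
      nontrivial_partition (residue_graph N) A (V `\` A)%fset ->
      odd_partition (residue_graph N) A (V `\` A)%fset.
Proof.
move=> m2; rewrite Selmer'_eq_trivial; split=> [S'T|[qs1 odd_ps]].
  have size_qs := Selmer'_size_qs S'T; split=> [|A A_ps]; first by rewrite size_qs m2.
  apply/(nontrivial_odd_partitionP sqfree_n prime_n_odd (subset_ps_V A_ps)) => AS; left.
  exact: (Selmer'_sub_trivialP size_qs).1 S'T A A_ps AS.
apply/Selmer'_sub_trivialP => [|A A_ps AS]; first by rewrite qs1 m2.
have := (nontrivial_odd_partitionP sqfree_n prime_n_odd (subset_ps_V A_ps)).1 (odd_ps A A_ps) AS.
by case=> // /(V_not_ps A_ps).
Qed.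

Lemma spanned_m d : spanned m%:Z d <-> spanned (- N) d.
Proof.
have dvd_Nn p : prime p -> (p %% 3 = 1)%N -> (p %| - N)%Z = (p %| m%:Z)%Z.
  move=> p_pr p1; rewrite [(p %| - N)%Z]rpredN prime_dvd_n // prime_dvd_m // inE.
  by have [p3|//] := eqVneq p 3; rewrite p3 in p1.
have spanE p (p_pr : prime p) : (p %| N)%Z -> (p %% 3 = 1)%N ->
    sqspan ((- N)%:~R : padic p_pr) d%:~R <-> sqspan (m%:Z%:~R : padic p_pr) d%:~R.
  move=> pN p1; have p3 : p != 3%N by apply: contra_eqN p1 => /eqP ->.
  have pN3 : ~~ (p %| (-3 : int))%Z by rewrite rpredN dvdzE /= dvdn_prime2.
  rewrite (_ : - N = m%:Z * -3); last by rewrite NE; ring.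
  rewrite rmorphM; apply: sqspan_gen_mul; first by rewrite Qp_intr_eq0.
  apply/is_square_intr => //; first exact: n_odd.
  exact/(is_square_N3_Fp p_pr (n_odd pN) p3).
split=> dS p p_pr pM p1; apply/(spanE p p_pr) => //.
- by rewrite -[(p %| N)%Z]rpredN.
- by apply: dS => //; rewrite -dvd_Nn.
- by rewrite -[(p %| N)%Z]rpredN dvd_Nn.
- by apply: dS => //; rewrite dvd_Nn.
Qed.

Lemma sqspan_Q3 (p_pr : prime 3) A : {subset A <= [seq x%:Z | x <- split_primes]} ->
  if split_prime m 3 then sqspan ((- N)%:~R : padic p_pr) (vertex_prod A)%:~R
  else is_square ((vertex_prod A)%:~R : padic p_pr).
Proof.
rewrite /split_prime /= /split_primes; case: ifP => [/eqP m2|_] A_sub; last first.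
  by apply: is_square_Q3; exact: vertex_prod_ps_mod3.
have square_of_ps D : {subset D <= [seq x%:Z | x <- ps]} ->
    sqspan ((- N)%:~R : padic p_pr) (vertex_prod D)%:~R.
  by move=> D_ps; left; apply: is_square_Q3; exact: vertex_prod_ps_mod3.
have [A3|A3] := boolP (3%:Z \in A); last first.
  apply: square_of_ps => v vA; have := A_sub v vA; rewrite /= inE => /predU1P [v3|//].
  by rewrite v3 (negPf A3) in vA.
rewrite (vertex_prodD1 A3) rmorphM; apply: sqspanM.
- by rewrite Qp_intr_eq0 oppr_eq0; exact: (sqfree_neq0 sqfree_n).
- right; rewrite -rmorphM (_ : - N * 3 = - m%:Z * 3 ^+ 2); last by rewrite NE; ring.
  rewrite rmorphM rmorphXn; apply: is_squareM; last exact: is_square_sqr.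
  by apply: is_square_Q3; move: m2; clear; lia.
apply: square_of_ps => v; rewrite in_fsetD1 => /andP [v3 /A_sub].
by rewrite /= inE (negPf v3).
Qed.

Lemma subset_split_V A : {subset A <= [seq x%:Z | x <- split_primes]} -> (A `<=` V)%fset.
Proof.
move=> A_split; apply/fsubsetP => v /A_split /mapP [x /split_primes_sub x_in ->].
by rewrite in_vertices_n map_f.
Qed.

Lemma Selmer_vertex_prodP A : {subset A <= [seq x%:Z | x <- split_primes]} ->
  Selmer R E (vertex_prod A) <->
  [/\ (4 %| vertex_prod A - 1)%Z, {in qs, forall q, legendre (vertex_prod A) q = 1}
    & spanned (- N) (vertex_prod A)].
Proof.
move=> A_split; have AV := subset_split_V A_split.
have A_in : sqfree_in N (vertex_prod A) := vertex_prod_sqfree_in sqfree_n AV.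
have A_gt0 := vertex_prod_gt0 AV.
have legendreP p (p_pr : prime p) : (p %| N)%Z ->
    is_square ((vertex_prod A)%:~R : padic p_pr) <-> legendre (vertex_prod A) p = 1.
  by move=> pN; apply: is_square_legendre; [exact: n_odd|exact: sqfree_in_sqfree A_in].
rewrite SelmerE; split=> [[_ A4 _ loc]|[A4 A_qs AS]]; split=> //.
- move=> q q_qs; have [q_pr _ q2] := qs_prime q_qs.
  have qN : (q %| N)%Z by rewrite prime_dvd_n // inE mem_cat q_qs !orbT.
  have := loc q q_pr qN; rewrite /split_prime q2 /=.
  by have [q3|_ /legendreP ->] := eqVneq q 3%N; first by rewrite q3 in q2.
- move=> p p_pr; rewrite [(p %| - N)%Z]rpredN => pN p1.
  by have := loc p p_pr pN; rewrite /split_prime p1.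
move=> p p_pr pN; have := pN; rewrite prime_dvd_n // inE mem_cat => /or3P [/eqP p3|p_ps|p_qs].
- by subst p; exact: sqspan_Q3.
- have [_ _ p1] := ps_prime p_ps; rewrite /split_prime p1.
  by apply: AS; rewrite ?[(p %| - N)%Z]rpredN.
have [_ _ p2] := qs_prime p_qs; rewrite /split_prime p2 /=.
have [p3|_] := eqVneq p 3%N; first by rewrite p3 in p2.
by apply/legendreP => //; exact: A_qs.
Qed.

(* At a prime that is not split the local image is trivial, so [d] is prime to it. *)
Lemma Selmer_as_vertex_prod d : Selmer R E d ->
  {subset vertices (residue_graph d) <= [seq x%:Z | x <- split_primes]} /\
  vertex_prod (vertices (residue_graph d)) = d.
Proof.
move=> /SelmerE [d_gt0 _ dN loc]; have d_sqfree := sqfree_in_sqfree dN.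
split; last exact/vertex_prod_graph.
move=> v /(vertexP d_sqfree) [[]|[r [r_pr rd ->]]]; first by rewrite ltNge ltW.
have rN := (dN r r_pr).2 rd; rewrite map_f // -mem_split_primes //.
apply: contraT => /negPf r_split; have := loc r r_pr rN; rewrite r_split.
by move/(uniformizer_nonsquare (uniformizer_intr r_pr rd (d_sqfree r r_pr))).
Qed.

Lemma Selmer_eq1P : Selmer R E = [set 1] <->
  forall A, {subset A <= [seq x%:Z | x <- split_primes]} -> (4 %| vertex_prod A - 1)%Z ->
    {in qs, forall q, legendre (vertex_prod A) q = 1} -> spanned (- N) (vertex_prod A) ->
    A = fset0.
Proof.
split=> [S1 A A_split A4 A_qs AS|trivial_A].
  suff : Selmer R E (vertex_prod A).
    by rewrite S1; exact: (vertex_prod_eq1 sqfree_n (subset_split_V A_split)).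
  exact/Selmer_vertex_prodP.
apply/seteqP; split=> [d Sd|_ ->].
  have [A_split AE] := Selmer_as_vertex_prod Sd; set A := vertices _ in A_split AE.
  rewrite -AE in Sd *; have [A4 A_qs AS] := (Selmer_vertex_prodP A_split).1 Sd.
  by rewrite (trivial_A A A_split A4 A_qs AS); exact: vertex_prod0.
rewrite -vertex_prod0; apply/Selmer_vertex_prodP; first by move=> v; rewrite in_fset0.
rewrite vertex_prod0; split=> [|q /qs_prime [q_pr q_odd _]|p p_pr _ _]; first by rewrite subrr.
  by apply/legendre_eq1 => //; split; [rewrite dvdzE dvdn1 gtn_eqF ?prime_gt1|exact: is_square1].
exact: sqspan1.
Qed.

Local Notation Vm := (vertices (residue_graph m%:Z)).

Lemma Selmer_eq1_mP : qs = [::] -> Selmer R E = [set 1] <->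
  forall A, (A `<=` Vm)%fset -> (4 %| vertex_prod A - 1)%Z -> spanned m%:Z (vertex_prod A) ->
    A = fset0.
Proof.
move=> qs0; have VmE v : (v \in Vm) = (v \in [seq x%:Z | x <- ps]).
  by rewrite in_vertices_m qs0 cats0.
have split_ps : split_primes = ps.
  by rewrite /split_primes mE qs0 cats0 prod_mod3 // => x /ps_prime [].
rewrite Selmer_eq1P split_ps qs0; split=> trivial_A A AV A4 => [/spanned_m|_ /spanned_m] AS.
  by apply: trivial_A => // v /(fsubsetP AV); rewrite VmE.
by apply: trivial_A => //; apply/fsubsetP => v /AV; rewrite VmE.
Qed.

(* If [m = 3 mod 4], exactly one of the two parts of a partition has product [1 mod 4];
   otherwise [m] itself is in the Selmer group. *)
Lemma Selmer_eq1_odd_graph : qs = [::] -> ps != [::] ->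
  Selmer R E = [set 1] <-> (n %% 24 = 9)%N /\ odd_graph (residue_graph m%:Z).
Proof.
move=> qs0 ps0; have m_odd p : prime p -> (p %| m%:Z)%Z -> odd p.
  by move=> _ pm; apply: n_odd; rewrite NE dvdz_mulr.
have Vm_neq0 : Vm <> fset0.
  case: (ps) in_vertices_m ps0 => // x s vmE _ Vm0.
  by have := vmE x%:Z; rewrite Vm0 in_fset0 mem_head.
have prod_Vm : vertex_prod Vm = m%:Z by exact/vertex_prod_graph/sqfree_m.
have n_mod24E : (n %% 24 == 9)%N = ~~ (4 %| m%:Z - 1)%Z.
  by move: n_mod24 nE; rewrite !inE; clear; lia.
rewrite (Selmer_eq1_mP qs0) (odd_graphP sqfree_m m_odd).
split=> [trivial_A|[n9 trivial_A] A AV A4 AS]; last first.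
  have [//|AVm] := trivial_A A AV AS; move/eqP: n9.
  by rewrite n_mod24E -prod_Vm -AVm A4.
have n9 : (n %% 24 == 9)%N.
  rewrite n_mod24E; apply/negP => m4; apply: Vm_neq0; apply: trivial_A; rewrite ?prod_Vm //.
  by move=> p p_pr _ _; exact: sqspan_id.
split=> [|A AV AS]; first exact/eqP.
have /orP [A4|B4] : (4 %| vertex_prod A - 1)%Z || (4 %| vertex_prod (Vm `\` A)%fset - 1)%Z.
- apply: mod4_factor; rewrite (vertex_prod_complement sqfree_m AV).
  by move: n9 n_mod24 nE; rewrite !inE; clear; lia.
- by left; exact: trivial_A.
right; apply/eqP; rewrite eqEfsubset AV -fsetD_eq0; apply/eqP.
exact: trivial_A (fsubsetDl _ _) B4 (spanned_complement sqfree_m AV AS).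
Qed.

Lemma Selmer_eq1_odd_partitions q : (m %% 3 = 2)%N -> qs = [:: q] ->
  Selmer R E = [set 1] <->
  forall A, {subset A <= 3 :: [seq x%:Z | x <- ps]} ->
    (vertex_prod A = 1 %[mod 4])%Z -> legendre (vertex_prod A) q = 1 ->
    nontrivial_partition (residue_graph (- N)) A (W `\` A)%fset ->
    odd_partition (residue_graph (- N)) A (W `\` A)%fset.
Proof.
move=> m2 qsE; have Nn_odd p : prime p -> (p %| - N)%Z -> odd p.
  by move=> _; rewrite rpredN; exact: n_odd.
have split_ps : split_primes = 3%N :: ps by rewrite /split_primes m2.
rewrite Selmer_eq1P split_ps qsE; split=> trivial_A A A_split.
  have AW : (A `<=` W)%fset.
    by apply: fsubset_trans V_sub_W; apply: subset_split_V; rewrite split_ps.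
  move=> /eqP; rewrite eqz_mod_dvd => A4 A_q.
  apply/(nontrivial_odd_partitionP sqfree_Nn Nn_odd AW) => AS; left.
  by apply: trivial_A => // x; rewrite inE => /eqP ->.
have AW : (A `<=` W)%fset.
  by apply: fsubset_trans V_sub_W; apply: subset_split_V; rewrite split_ps.
move=> A4 A_q AS.
have [||//|AE] :=
  (nontrivial_odd_partitionP sqfree_Nn Nn_odd AW).1 (trivial_A A A_split _ _) AS.
- by apply/eqP; rewrite eqz_mod_dvd.
- by apply: A_q; rewrite mem_head.
have /A_split /mapP [] // : -1 \in A by rewrite AE in_vertices_Nn.
Qed.

End SelmerGroups.

Theorem theorem5p1 (R : realType) (t s : nat)
    (p : t.-tuple nat) (q : s.-tuple nat) (n P Q : nat)
    (p_prime : forall x, x \in p -> prime x /\ odd x /\ x = 1 %[mod 3])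
    (q_prime : forall x, x \in q -> prime x /\ odd x /\ x = 2 %[mod 3])
    (pq_distinct : uniq (p ++ q))
    (ts_ge1 : (1 <= t + s)%N)
    (defP : P = (\prod_(x <- p) x)%N)
    (defQ : Q = (\prod_(x <- q) x)%N)
    (defn : n = (3 * P * Q)%N)
    (n_mod24 : (n %% 24)%N \in [:: 3; 9; 15]%N) :
  let E := curve_pi3 n in
  let S := Selmer R E in
  let S' := Selmer' R E in
  let V := vertices (residue_graph n%:Z) in
  let W := vertices (residue_graph (- n%:Z)) in
  [/\ (P * Q = 1 %[mod 3])%N ->
        (S' = [set 1; n%:Z; - (n %/ 3)%:Z; - 3] <->
         s = 0%N /\ odd_graph (residue_graph n%:Z)),
      (P * Q = 2 %[mod 3])%N ->
        (S' = [set 1; n%:Z; - (n %/ 3)%:Z; - 3] <->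
         s = 1%N /\
         forall V1 : {fset int},
           {subset V1 <= [seq x%:Z | x <- p]} ->
           nontrivial_partition (residue_graph n%:Z) V1 (V `\` V1)%fset ->
           odd_partition (residue_graph n%:Z) V1 (V `\` V1)%fset),
      (P * Q = 1 %[mod 3])%N -> s = 0%N ->
        (S = [set 1] <->
         n = 9 %[mod 24] /\ odd_graph (residue_graph (n %/ 3)%:Z))
    & (P * Q = 2 %[mod 3])%N -> s = 1%N ->
        (S = [set 1] <->
         forall V1 : {fset int},
           {subset V1 <= 3 :: [seq x%:Z | x <- p]} ->
           (vertex_prod V1 = 1 %[mod 4])%Z ->
           legendre (vertex_prod V1) (nth 0%N q 0) = 1 ->
           nontrivial_partition (residue_graph (- n%:Z)) V1 (W `\` V1)%fset ->
           odd_partition (residue_graph (- n%:Z)) V1 (W `\` V1)%fset)].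
Proof.
have ps_prime x : x \in tval p -> [/\ prime x, odd x & (x %% 3 = 1)%N].
  by move=> /p_prime [x_pr [x_odd x1]].
have qs_prime x : x \in tval q -> [/\ prime x, odd x & (x %% 3 = 2)%N].
  by move=> /q_prime [x_pr [x_odd x2]].
have mE : (P * Q = \prod_(x <- tval p ++ tval q) x)%N by rewrite big_cat -defP -defQ.
have nE : n = (3 * (P * Q))%N by rewrite mulnA.
have -> : (n %/ 3)%N = (P * Q)%N by rewrite nE mulKn.
move=> E S S' V W; split=> PQ.
- rewrite -(size_tuple q).
  exact: (Selmer'_eq_trivial_odd_graph R ps_prime qs_prime pq_distinct mE nE n_mod24).
- rewrite -(size_tuple q).
  exact: (Selmer'_eq_trivial_odd_partitions R ps_prime qs_prime pq_distinct mE nE n_mod24).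
- move=> s0; apply: (Selmer_eq1_odd_graph R ps_prime qs_prime pq_distinct mE nE n_mod24).
    by apply: size0nil; rewrite size_tuple.
  by rewrite -size_eq0 size_tuple -lt0n; move: ts_ge1; rewrite s0 addn0.
- move=> s1; apply: (Selmer_eq1_odd_partitions R ps_prime qs_prime pq_distinct mE nE n_mod24 PQ).
  by have := etrans (size_tuple q) s1; case: (tval q) => [|x []].
Qed.
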